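(* Let $n\ge2$, let $(X,T)$ be a minimal system and let $\pi\colon(X,T)\to(X_{eq},T_{eq})$ be the factor map to its maximal equicontinuous factor. Let $\mathcal{F}=\mathcal{F}_{ps}$ or $\mathcal{F}=\mathcal{F}_{pubd}$. Then $(X,T)$ is broken $\mathcal{F}$-$n$-sensitive if and only if there exist $y\in X_{eq}$ and pairwise distinct points $x_1,\dots,x_n\in\pi^{-1}(y)$ such that $(x_1,\dots,x_n)$ is an $\mathcal{F}$-recurrent point of $(X^n,T^{(n)})$.
   Context: A (topological dynamical) system $(X,T)$ is a compact metric space $X$ with metric $d$ and a continuous surjective map $T\colon X\to X$; it is minimal if it has no proper non-empty closed $T$-invariant subset. $(X^n,T^{(n)})$ is the $n$-fold product system with $T^{(n)}=T\times\cdots\times T$. $\mathbb{Z}_+=\{0,1,2,\dots\}$, $\mathbb{N}=\{1,2,\dots\}$. ''Opene'' means non-empty open. A factor map $\pi\colon(X,T)\to(Y,S)$ is a continuous surjection with $\pi\circ T=S\circ\pi$. A system is equicontinuous if for every $\varepsilon>0$ there is $\delta>0$ such that $d(x,y)<\delta$ implies $d(T^mx,T^my)<\varepsilon$ for all $m\in\mathbb{N}$. The maximal equicontinuous factor $(X_{eq},T_{eq})$ is the equicontinuous factor of $(X,T)$ such that every equicontinuous factor of $(X,T)$ is a factor of it; it is the quotient of $X$ by the smallest closed $T\times T$-invariant equivalence relation with equicontinuous quotient. A Furstenberg family is a collection of subsets of $\mathbb{Z}_+$ that is closed under taking supersets in $\mathbb{Z}_+$. A set $A\subset\mathbb{Z}_+$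 is thick if for every $l\ge1$ there is $n_l\in\mathbb{N}$ with $\{n_l,\dots,n_l+l\}\subset A$; syndetic if there is $N\in\mathbb{N}$ such that $\{k,\dots,k+N\}\cap A\ne\emptyset$ for every $k\in\mathbb{N}$; piecewise syndetic if it is the intersection of a thick set and a syndetic set. $\mathcal{F}_{ps}$ is the family of piecewise syndetic subsets of $\mathbb{Z}_+$. $\mathcal{F}_{pubd}$ is the family of $A\subset\mathbb{Z}_+$ with $\limsup_{b-a\to\infty}\frac{|A\cap\{a,a+1,\dots,b-1\}|}{b-a}>0$ (positive upper Banach density). For a family $\mathcal{F}$ and a system $(Y,S)$, a point $y\in Y$ is $\mathcal{F}$-recurrent if $\{k\in\mathbb{Z}_+: S^ky\in U\}\in\mathcal{F}$ for every neighbourhood $U$ of $y$. $(X,T)$ is broken $\mathcal{F}$-$n$-sensitive if there exist $\delta>0$ and $F\in\mathcal{F}$ such that for every opene $U\subset X$ and every $l\in\mathbb{N}$ there exist $x_1^l,\dots,x_n^l\in U$ and $m_l\in\mathbb{Z}_+$ with $\min_{1\le i<j\le n}d(T^kx_i^l,T^kx_j^l)>\delta$ for all $k\in m_l+(F\cap[1,l])$. *)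

(* Defs.v *)
From HB Require Import structures.
From mathcomp Require Import all_boot all_order all_algebra.
From mathcomp Require Import all_classical all_reals all_analysis.

Set Implicit Arguments.
Unset Strict Implicit.
Unset Printing Implicit Defensive.

Import Order.TTheory GRing.Theory Num.Theory.

Local Open Scope classical_set_scope.
Local Open Scope ring_scope.

(* A metricType carries a genuine distance mdist. As usual in topological
   dynamics, the phase space is non-empty: on the empty space sensitivity would
   hold vacuously. *)
Record is_system (R : realType) (X : metricType R) (T : X -> X) : Prop := {
  system_nonempty : [set: X] !=set0;
  system_compact : compact [set: X];
  system_continuous : continuous T;
  system_surjective : range T = [set: X]
}.

Definition is_minimal (R : realType) (X : metricType R) (T : X -> X) : Prop :=
  is_system T /\
  forall A : set X,
    closed A -> A !=set0 -> T @` A `<=` A -> A = [set: X].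

Definition is_factor_map (R : realType) (X Y : metricType R)
    (T : X -> X) (S : Y -> Y) (pi : X -> Y) : Prop :=
  [/\ continuous pi, range pi = [set: Y] & forall x, pi (T x) = S (pi x)].

Definition is_equicontinuous (R : realType) (X : metricType R) (T : X -> X)
    : Prop :=
  forall eps : R, 0 < eps -> exists2 delta : R, 0 < delta &
    forall x y : X, mdist x y < delta ->
      forall m : nat, (1 <= m)%N -> mdist (iter m T x) (iter m T y) < eps.

(* (Y, S), together with pi, is an equicontinuous factor of (X, T) through
   which every equicontinuous factor psi of (X, T) factorizes; equivalently,
   the kernel of pi is the smallest closed T x T-invariant equivalence relation
   with equicontinuous quotient. *)
Definition is_max_equicontinuous_factor (R : realType) (X Y : metricType R)
    (T : X -> X) (S : Y -> Y) (pi : X -> Y) : Prop :=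
  [/\ is_system S, is_equicontinuous S, is_factor_map T S pi &
   forall (Z : metricType R) (Q : Z -> Z) (psi : X -> Z),
     is_system Q -> is_equicontinuous Q -> is_factor_map T Q psi ->
     exists2 phi : Y -> Z, is_factor_map S Q phi & psi = phi \o pi].

Definition thick (A : set nat) : Prop :=
  forall l : nat, (1 <= l)%N -> exists2 n : nat, (1 <= n)%N &
    forall k : nat, (n <= k <= n + l)%N -> A k.

Definition syndetic (A : set nat) : Prop :=
  exists2 N : nat, (1 <= N)%N &
    forall k : nat, (1 <= k)%N -> exists2 j : nat, (k <= j <= k + N)%N & A j.

Definition F_ps : set (set nat) :=
  [set A | exists B C : set nat, [/\ thick B, syndetic C & A = B `&` C]].

(* The filter "b - a tends to infinity" on the pairs (a, b). *)
Definition gap_to_infty : set (set (nat * nat)) :=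
  [set V | exists N : nat, forall a b : nat, (a + N <= b)%N -> V (a, b)].

Definition upper_banach_density (R : realType) (A : set nat) : \bar R :=
  limf_esup (fun p : nat * nat =>
      ((\sum_(p.1 <= k < p.2) (k \in A))%N%:R / (p.2 - p.1)%N%:R)%:E)
    gap_to_infty.

Definition F_pubd (R : realType) : set (set nat) :=
  [set A | (0 < upper_banach_density R A)%E].

Definition recurrent_point (F : set (set nat)) (Y : topologicalType)
    (S : Y -> Y) (y : Y) : Prop :=
  forall U : set Y, nbhs y U -> F [set k : nat | U (iter k S y)].

(* T x ... x T on X^n, which carries the product topology. *)
Definition prod_map (n : nat) (X : topologicalType) (T : X -> X)
    : {ptws 'I_n -> X} -> {ptws 'I_n -> X} :=
  fun x i => T (x i).

Definition broken_sensitive (F : set (set nat)) (n : nat)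
    (R : realType) (X : metricType R) (T : X -> X) : Prop :=
  exists delta : R, 0 < delta /\
  exists2 A : set nat, F A &
    forall U : set X, open U -> U !=set0 ->
    forall l : nat, (1 <= l)%N ->
    exists (x : 'I_n -> X) (m : nat),
      (forall i, U (x i)) /\
      forall p : nat, A p -> (1 <= p <= l)%N ->
      forall i j : 'I_n, (i < j)%N ->
        delta < mdist (iter (m + p) T (x i)) (iter (m + p) T (x j)).

(* Main.v *)
From HB Require Import structures.
Require Import Defs.
From mathcomp Require Import all_boot all_order all_algebra.
From mathcomp Require Import all_classical all_reals all_analysis.
From mathcomp Require Import zify lra.

(** Write [S] for the product map on tuples.

    Broken sensitivity gives a recurrent tuple. A limit of the separated tuples
    provided by smaller and smaller balls is a tuple [z] inside one fibre of
    [pi], by equicontinuity of the factor, whose orbit is in the closed set [W]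
    of separated tuples of a fibre at the times of a set of the family
    ([broken_sensitive_orbit]). It remains to find in [W] a point which is
    recurrent for the family. In the piecewise syndetic case it is taken in a
    minimal set meeting [W] ([F_ps_visits_recurrent]). In the Banach density
    case it is obtained as a density point of [W]: a maximal inequality shows
    that one can shrink [W] to smaller and smaller closed sets of positive
    density all of whose points return often to them ([large_good],
    [large_dense_visits]).

    A recurrent tuple [x] in a fibre gives broken sensitivity. The heart is that
    the maximal equicontinuous factor controls closed invariant sets of tuples.
    Let [N x] be the sections of a closed invariant subset of [X * E]. Given an
    invariant measure [m] on [E], the number [m (N x)] does not depend on [x]
    because [X] is minimal, and the measure of the symmetric difference of
    [N x] and [N y] is a continuous nonexpanding pseudo-distance. Its quotient is
    an equicontinuous factor, so it vanishes on the fibres of [pi]. This is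
    McMahon's argument. The measure is replaced here by the outer regularization
    of a finitely additive mean along one orbit, the orbit being chosen to visit
    often the open set of interest ([fiber_transfer]).
    Changing coordinates one at a time within fibres then shows that the closure
    of the forward orbit of a cube [U x ... x U] contains all tuples of points
    lying over any open set contained in the image of [U]
    ([closed_invariant_saturated]). Replacing [U] by some preimage under an
    iterate, the image has interior ([factor_semi_open]), which some iterate of
    [x] lies over, since the orbits of [X] are dense. The forward orbit of the
    cube thus meets every neighbourhood of this iterate, and by recurrence of [x]
    such a neighbourhood can be made to follow, after some more time, any finite
    part of the orbit of [x]. The set of times at which [x] is separated is then
    the one required. *)

Set Implicit Arguments.
Unset Strict Implicit.
Unset Printing Implicit Defensive.

Import Order.TTheory GRing.Theory Num.Theory numFieldNormedType.Exports.

Local Open Scope classical_set_scope.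
Local Open Scope ring_scope.

(** * Open sets and compactness *)

Lemma open_forall (I : finType) (E : topologicalType) (P : I -> set E) :
  (forall i, open (P i)) -> open [set e | forall i, P i e].
Proof.
move=> oP; rewrite openE => e Pe.
by apply: (@filter_forall _ _ P (nbhs e)) => i; apply: open_nbhs_nbhs; split.
Qed.

Lemma open_imply (E : topologicalType) (c : Prop) (P : set E) :
  (c -> open P) -> open [set e | c -> P e].
Proof.
move=> oP; have [hc|nc] := pselect c.
  have -> : [set e | c -> P e] = P.
    by apply/seteqP; split => e //= h; exact: h.
  exact: oP.
have -> : [set e | c -> P e] = setT by apply/seteqP; split => // e _ /nc.
exact: openT.
Qed.

(** Near [x], membership in [f x] holds with [x] itself as a centre, and [x]
    eventually belongs to the sequence along the filter of larger and larger
    finite sequences; compactness makes this uniform in [x]. *)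
Lemma compact_finite_subcover (E : topologicalType) (A : set E)
    (f : E -> set E) :
  compact A -> (forall x, A x -> nbhs x (f x)) ->
  exists s : seq E, (forall y, y \in s -> A y) /\
    forall x, A x -> exists2 y, y \in s & f y x.
Proof.
move=> /compact_near_coveringP cA fA.
pose F : set_system (seq E) := filter_from [set: seq E]
  (fun s : seq E => [set t : seq E | {subset s <= t}]).
have FF : Filter F.
  apply: filter_from_filter; first by exists [::].
  move=> s t _ _; exists (s ++ t) => // w st; split => x xs; apply: st;
    by rewrite mem_cat xs ?orbT.
have [|s _ sP] := cA _ F (fun s x => exists2 y, y \in s & A y /\ f y x) FF.
  move=> x Ax; exists (f x, [set t | x \in t]) => /=.
    split; [exact: fA|exists [:: x] => // t xt /=].
    by apply: xt; rewrite mem_seq1.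
  by move=> [x' t] [fx xt]; exists x.
exists [seq y <- s | `[< A y >]]; split=> [y|x Ax].
  by rewrite mem_filter => /andP[/asboolP].
have [//|y ys [Ay fyx]] := sP s _ x Ax.
by exists y => //; rewrite mem_filter ys andbT; apply/asboolP.
Qed.

Lemma compact_bigcap_nonempty (E : topologicalType) (K : nat -> set E) :
  compact [set: E] -> (forall j, closed (K j)) -> (forall j, K j !=set0) ->
  (forall j, K j.+1 `<=` K j) -> exists e, forall j, K j e.
Proof.
move=> /compact_near_coveringP cE cK K0 dK; apply: contrapT => nK.
have mK i j : (i <= j)%N -> K j `<=` K i.
  elim: j => [|j IH]; first by rewrite leqn0 => /eqP ->.
  by rewrite leq_eqVlt => /predU1P[->//|ij]; apply: subset_trans (IH ij).
have [|N _ /(_ N (leqnn N)) H] := cE _ \oo (fun j e => ~ K j e) _.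
  move=> x _; have [j nj] : exists j, ~ K j x.
    by apply: contrapT => h; apply: nK; exists x => j; apply: contrapT => ?; apply: h; exists j.
  exists (~` K j, [set i | (j <= i)%N]) => /=.
    split; last by exists j.
    by apply: open_nbhs_nbhs; split => //; rewrite openC.
  by move=> [y i] [nyj ji] /(mK _ _ ji).
by have [e Ke] := K0 N; apply: (H e).
Qed.

(** If the open set is not inside the first closed set, what remains of it is
    open, non-empty and covered by the others. *)
Lemma closed_seq_cover_interior (Y : topologicalType) (I : eqType) (C : I -> set Y)
    (s : seq I) (O : set Y) :
  (forall i, closed (C i)) -> open O -> O !=set0 ->
  (forall y, O y -> exists2 i, i \in s & C i y) ->
  exists2 i, i \in s & exists J, [/\ open J, J !=set0 & J `<=` C i].
Proof.
move=> cC; elim: s O => [|i s IH] O oO [y Oy] sO; first by have [] := sO _ Oy.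
have [OC|nOC] := pselect (O `<=` C i).
  by exists i; [rewrite mem_head|exists O; split => //; exists y].
have [|||j js Jj] := IH (O `&` ~` C i).
- by apply: openI => //; rewrite openC.
- by apply: contrapT => h; apply: nOC => x Ox; apply: contrapT => ?; apply: h; exists x.
- move=> x [Ox nx]; have [j] := sO _ Ox.
  by rewrite inE => /predU1P[->//|js] Cx; exists j.
by exists j => //; rewrite inE js orbT.
Qed.

Lemma continuous_iter (E : topologicalType) (S : E -> E) :
  continuous S -> forall k, continuous (iter k S).
Proof.
move=> cS; elim=> [|k IH] x; first exact: cvg_id.
exact: continuous_comp (IH x) (cS _).
Qed.

Lemma open_iter (E : topologicalType) (S : E -> E) (O : set E) k :
  continuous S -> open O -> open [set e | O (iter k S e)].
Proof. by move=> cS oO; apply: open_comp => // x _; exact: continuous_iter. Qed.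

Lemma closed_iter (E : topologicalType) (S : E -> E) (C : set E) k :
  continuous S -> closed C -> closed [set e | C (iter k S e)].
Proof. by move=> cS oO; apply: preimage_closed => // x _; exact: continuous_iter. Qed.

(** * Minimal sets *)

Definition forward_invariant (E : Type) (S : E -> E) (C : set E) :=
  forall e, C e -> C (S e).

Lemma forward_invariant_iter (E : Type) (S : E -> E) (C : set E) k e :
  forward_invariant S C -> C e -> C (iter k S e).
Proof. by move=> iC Ce; elim: k => //= k /iC. Qed.

Definition minimal_set (E : topologicalType) (S : E -> E) (M : set E) :=
  [/\ closed M, M !=set0, forward_invariant S M &
   forall M', closed M' -> M' !=set0 -> forward_invariant S M' -> M' `<=` M ->
     M `<=` M'].

(** The closed invariant subsets are handled through their relative
    complements in [C], so that unions of chains of complements match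
    intersections of chains of closed sets; such an intersection is non-empty by
    compactness. *)
Lemma exists_minimal_set (E : topologicalType) (S : E -> E) (C : set E) :
  compact [set: E] -> closed C -> C !=set0 -> forward_invariant S C ->
  exists2 M, minimal_set S M & M `<=` C.
Proof.
move=> cE cC C0 iC.
pose P (A : set E) := [/\ closed (C `\` A), C `\` A !=set0 & forward_invariant S (C `\` A)].
have [F FP tF|A [[cA A0 iA] maxA]] := @Zorn_bigcup E P.
  have bigE : C `\` \bigcup_(X in F) X = C `&` \bigcap_(X in F) (C `\` X).
    apply/seteqP; split => x [Cx h]; split => //.
      by move=> X FX; split => // Xx; apply: h; exists X.
    by move=> [X FX Xx]; have [_] := h _ FX.
  rewrite /P bigE; split.
  - by apply: closedI => //; apply: closed_bigI => X /FP[].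
  - have [[X0 FX0]|F0] := pselect (F !=set0); last first.
      by have [e Ce] := C0; exists e; split => // X FX; exfalso; apply: F0; exists X.
    pose G := filter_from F (fun X => C `\` X).
    have GF : Filter G.
      apply: filter_from_filter; first by exists X0.
      move=> X Y FX FY; have [XY|YX] := tF _ _ FX FY; [exists Y|exists X] => //;
        by move=> e [Ce ne]; split; split => // h; apply: ne; first [exact: XY|exact: YX | done].
    have GP : ProperFilter G by apply: filter_from_proper => // X /FP[].
    have [|e [_ cle]] := cE G GP.
      by exists X0.
    have h X : F X -> (C `\` X) e.
      move=> FX; have [cX _ _] := FP _ FX; apply: cX => B nB.
      by apply: cle => //; exists X.
    by exists e; split => //; have [] := h _ FX0.
  - move=> e [Ce h]; split; first exact: iC.
    by move=> X FX; have [_ _ iX] := FP _ FX; apply: iX; exact: h.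
exists (C `\` A); last by move=> e [].
split=> // M' cM' M'0 iM' M'A e [Ce nAe].
apply: contrapT => nM'e; apply: (maxA (A `|` (C `\` M'))).
  by split=> [x Ax|/(_ e) h]; [left|apply: nAe; apply: h; right].
suff E' : C `\` (A `|` (C `\` M')) = M' by rewrite /P E'.
  apply/seteqP; split => x.
    by move=> [Cx h]; apply: contrapT => nM'x; apply: h; right.
  by move=> M'x; have [Cx nAx] := M'A _ M'x; split => // -[//|[]].
Qed.

(** Otherwise the points whose orbit avoids [G] would form a smaller closed
    invariant set. *)
Lemma minimal_set_hits (E : topologicalType) (S : E -> E) (M G : set E) :
  continuous S -> minimal_set S M -> open G -> M `&` G !=set0 ->
  forall w, M w -> exists j, G (iter j S w).
Proof.
move=> cS [cM _ iM mM] oG [g [Mg Gg]] w Mw; apply: contrapT => nG.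
pose M' := M `&` \bigcap_j [set e | (~` G) (iter j S e)].
have /(_ g Mg) [_ /(_ 0%N Logic.I)] // : M `<=` M'.
apply: mM.
- apply: closedI => //; apply: closed_bigI => j _; apply: closed_iter => //.
  by rewrite closedC.
- by exists w; split => // j _ Gj; apply: nG; exists j.
- move=> e [Me h]; split; first exact: iM.
  by move=> j _; have := h j.+1 Logic.I; rewrite /= -iterSr.
- by move=> e [].
Qed.

(** The hitting times of an open set are bounded uniformly by compactness; this
    is why points of minimal sets return with bounded gaps. *)
Lemma minimal_set_syndetic (E : topologicalType) (S : E -> E) (M G : set E) :
  compact [set: E] -> continuous S -> minimal_set S M -> open G ->
  M `&` G !=set0 ->
  exists N, forall w, M w -> exists2 j, (j <= N)%N & G (iter j S w).
Proof.
move=> cE cS mM oG MG; have [cM _ _ _] := mM.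
have /compact_near_coveringP cM' : compact M by apply: subclosed_compact cE _.
have [|N _ /(_ N (leqnn N)) H] :=
  cM' _ \oo (fun N e => exists2 j, (j <= N)%N & G (iter j S e)) _.
  move=> w Mw; have [j Gj] := minimal_set_hits cS mM oG MG Mw.
  exists ([set e | G (iter j S e)], [set i | (j <= i)%N]) => /=.
    split; last by exists j.
    by apply: open_nbhs_nbhs; split => //; exact: open_iter.
  by move=> [e i] [Ge ji]; exists j.
by exists N.
Qed.

(** * Metric spaces and their finite powers *)

Section Product.
Variables (R : realType) (X : metricType R).

Lemma nbhs_mdistP (x : X) (V : set X) :
  nbhs x V <-> exists2 e : R, 0 < e & forall y, mdist x y < e -> V y.
Proof.
rewrite -nbhs_ballE; split=> [[e e0 eV]|[e e0 eV]]; exists e => //.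
  by move=> y xy; apply: eV; rewrite ballEmdist.
by move=> y; rewrite ballEmdist; exact: eV.
Qed.

Lemma near_mdist_lt (x : X) (e : R) : 0 < e -> nbhs x [set y | mdist x y < e].
Proof. by move=> e0; apply/nbhs_mdistP; exists e. Qed.

Lemma open_mdist_gt (Y : topologicalType) (f g : Y -> X) (d : R) :
  continuous f -> continuous g -> open [set y | d < mdist (f y) (g y)].
Proof.
move=> cf cg; rewrite openE => y /= dy; pose e := (mdist (f y) (g y) - d) / 2.
have e0 : 0 < e by rewrite divr_gt0 // subr_gt0.
have F1 : nbhs y [set z | mdist (f y) (f z) < e] := cf y _ (near_mdist_lt (f y) e0).
have F2 : nbhs y [set z | mdist (g y) (g z) < e] := cg y _ (near_mdist_lt (g y) e0).
rewrite /interior; apply: filterS2 F1 F2 => z /= fz gz.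
have := metric_triangle (f y) (f z) (g y).
have := metric_triangle (f z) (g z) (g y); rewrite (metric_sym (g z) (g y)).
rewrite /e in fz gz; lra.
Qed.

Lemma open_mdist_lt (Y : topologicalType) (f g : Y -> X) (d : R) :
  continuous f -> continuous g -> open [set y | mdist (f y) (g y) < d].
Proof.
move=> cf cg; rewrite openE => y /= dy; pose e := (d - mdist (f y) (g y)) / 2.
have e0 : 0 < e by rewrite divr_gt0 // subr_gt0.
have F1 : nbhs y [set z | mdist (f y) (f z) < e] := cf y _ (near_mdist_lt (f y) e0).
have F2 : nbhs y [set z | mdist (g y) (g z) < e] := cg y _ (near_mdist_lt (g y) e0).
rewrite /interior; apply: filterS2 F1 F2 => z /= fz gz.
have := metric_triangle (f z) (f y) (g z); rewrite (metric_sym (f z) (f y)).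
have := metric_triangle (f y) (g y) (g z).
rewrite /e in fz gz; lra.
Qed.

Variable n : nat.
Implicit Types u v : {ptws 'I_n -> X}.

Lemma ptws_coord_continuous (i : 'I_n) : continuous (fun u => u i).
Proof. exact: proj_continuous. Qed.

(** On a finite power, coordinatewise uniform balls form a basis of the product
    topology. *)
Lemma ptws_nbhsP u (V : set {ptws 'I_n -> X}) :
  nbhs u V <-> exists2 e : R, 0 < e &
    forall v, (forall i, mdist (u i) (v i) < e) -> V v.
Proof.
split; last first.
  move=> [e e0 eV]; apply: (filterS eV).
  apply: (@filter_forall _ _ (fun i v => mdist (u i) (v i) < e) (nbhs u)) => i.
  exact: (ptws_coord_continuous (near_mdist_lt (u i) e0)).
pose G : set_system {ptws 'I_n -> X} := filter_from [set e : R | 0 < e]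
  (fun e => [set v | forall i, mdist (u i) (v i) < e]).
have GF : Filter G.
  apply: filter_from_filter; first by exists 1 => /=.
  move=> a b /= a0 b0; exists (Num.min a b); first by rewrite /= lt_min a0.
  by move=> v h; split=> i; have := h i; rewrite lt_min => /andP[].
have Gu : G --> u.
  apply/cvg_sup => i; apply/cvg_image.
    by rewrite eqEsubset; split=> v // _; exists (cst v).
  apply: cvg_trans; last exact: cvg_id.
  move=> W /= /nbhs_mdistP [e e0 eW].
  exists [set v | W (v i)].
    by exists e => //= v /(_ i) /eW.
  by rewrite image_preimage // eqEsubset; split=> v // _; exists (cst v).
by move=> /Gu [e e0 eV]; exists e.
Qed.

Lemma ptws_coord_comp_continuous (Y : topologicalType) (f : X -> Y) (i : 'I_n) :
  continuous f -> continuous (fun u : {ptws 'I_n -> X} => f (u i)).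
Proof.
move=> cf u; apply: (@continuous_comp _ _ _ (fun u : {ptws 'I_n -> X} => u i) f).
  exact: ptws_coord_continuous.
exact: cf.
Qed.

Lemma ptws_continuous (Y : topologicalType) (f : Y -> {ptws 'I_n -> X}) :
  (forall i, continuous (fun y => f y i)) -> continuous f.
Proof.
move=> cf y V /ptws_nbhsP [e e0 eV].
apply: (filterS (P := [set z | forall i, mdist (f y i) (f z i) < e])) => [z|].
  exact: eV.
apply: (@filter_forall _ _ (fun i z => mdist (f y i) (f z i) < e) (nbhs y)) => i.
exact: (cf i y _ (near_mdist_lt _ e0)).
Qed.

Lemma ptws_compact : compact [set: X] -> compact [set: {ptws 'I_n -> X}].
Proof.
move=> cX; have := @tychonoff _ (fun _ : 'I_n => X) (fun _ => setT) (fun _ => cX).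
by congr (compact _); apply/seteqP; split.
Qed.

Lemma ptws_hausdorff : hausdorff_space {ptws 'I_n -> X}.
Proof. by apply: hausdorff_product => i; exact: metric_hausdorff. Qed.

Lemma prod_map_continuous (T : X -> X) :
  continuous T -> continuous (@prod_map n X T).
Proof.
move=> cT; apply: ptws_continuous => i u.
exact: (@ptws_coord_comp_continuous X T i cT u).
Qed.

Lemma iter_prod_map (T : X -> X) k u i :
  iter k (@prod_map n X T) u i = iter k T (u i).
Proof. by elim: k => //= k IH; rewrite /prod_map IH. Qed.

End Product.

(** * Visit counts and means along an orbit *)

Definition visits (E : Type) (S : E -> E) (A : set E) (e : E) (L : nat) : nat :=
  \sum_(0 <= k < L) (iter k S e \in A).

Section Visits.
Variables (E : Type) (S : E -> E).
Implicit Types (A B : set E) (e : E).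

Lemma visits_add A e L M :
  visits S A e (L + M) = (visits S A e L + visits S A (iter L S e) M)%N.
Proof.
rewrite /visits (@big_cat_nat _ _ _ L) ?leq_addr //=; congr addn.
rewrite -{1}[L]add0n big_addn addnC addnK; apply: eq_bigr => k _.
by rewrite iterD.
Qed.

Lemma visits1 A e : visits S A e 1 = (e \in A) :> nat.
Proof. by rewrite /visits big_nat1. Qed.

Lemma visits0 A e : visits S A e 0 = 0%N.
Proof. by rewrite /visits big_geq. Qed.

Lemma visitsS A e L : visits S A e L.+1 = ((e \in A) + visits S A (S e) L)%N.
Proof. by rewrite -[L.+1]add1n visits_add visits1. Qed.

Lemma visitsSr A e L : visits S A e L.+1 = (visits S A e L + (iter L S e \in A))%N.
Proof. by rewrite -[L.+1]addn1 visits_add visits1. Qed.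

Lemma visits_le_length A e L : (visits S A e L <= L)%N.
Proof. by elim: L => [|L IH]; rewrite ?visits0 // visitsSr; case: (_ \in _) => /=; lia. Qed.

Lemma visits_subset A B e L : A `<=` B -> (visits S A e L <= visits S B e L)%N.
Proof.
move=> AB; apply: leq_sum => k _; case: (boolP (_ \in A)) => // /set_mem /AB.
by move=> /mem_set ->.
Qed.

Lemma visits_modular A B e L :
  (visits S (A `|` B) e L + visits S (A `&` B) e L =
   visits S A e L + visits S B e L)%N.
Proof.
elim: L => [|L IH]; rewrite ?visits0 // !visitsSr in_setU in_setI.
by case: (_ \in A); case: (_ \in B) => /=; lia.
Qed.

Lemma visits_set0 e L : visits S set0 e L = 0%N.
Proof. by elim: L => [|L IH]; rewrite ?visits0 // visitsSr IH in_set0. Qed.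

Lemma visits_orbit A e L : (forall k, A (iter k S e)) -> visits S A e L = L.
Proof.
move=> h; elim: L => [|L IH]; rewrite ?visits0 // visitsSr IH mem_set ?addn1 //.
Qed.

Lemma visits_preimage A e L :
  (visits S (S @^-1` A) e L + (e \in A) = visits S A e L + (iter L S e \in A))%N.
Proof.
elim: L => [|L IH]; first by rewrite !visits0.
have -> : visits S (S @^-1` A) e L.+1 =
   (visits S (S @^-1` A) e L + (iter L.+1 S e \in A))%N.
  by rewrite visitsSr.
by rewrite visitsSr; lia.
Qed.

End Visits.

Lemma ultra_cvg (R : realType) (I : Type) (U : set_system I) (a : I -> R) :
  UltraFilter U -> (forall i, 0 <= a i <= 1) -> cvg (a @ U).
Proof.
move=> UU a01; have [|l [_ cl]] :=
  @segment_compact R 0 1 (a @ U) (fmap_proper_filter a ultra_proper).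
  by apply: nearW => i; rewrite /= in_itv /=; exact: a01.
apply: (cvgP l) => V Vl.
have [//|UnV] := in_ultra_setVsetC (a @^-1` V) UU.
have [x [/= nVx Vx]] : (~` V) `&` V !=set0 by apply: cl.
by [].
Qed.

(** A finitely additive invariant measure defined on all subsets. Additivity is
    stated as modularity because a version of it passes to [outer]. *)
Record is_mean (R : realType) (E : Type) (S : E -> E) (D : set E -> R) : Prop := {
  mean_subset : forall A B, A `<=` B -> D A <= D B;
  mean_modular : forall A B, D (A `|` B) + D (A `&` B) = D A + D B;
  mean_set0 : D set0 = 0;
  mean_preimage : forall A, D (S @^-1` A) = D A
}.

Lemma mean_ge0 (R : realType) (E : Type) (S : E -> E) (D : set E -> R) A :
  is_mean S D -> 0 <= D A.
Proof. by move=> mD; rewrite -(mean_set0 mD); apply: (mean_subset mD). Qed.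

(** An ultrafilter finer than the one at infinity turns visit frequencies into
    a limit for all subsets at once. Replacing [A] by its preimage changes the
    number of visits before time [L] by at most 1, hence the invariance. *)
Lemma exists_orbit_mean (R : realType) (E : Type) (S : E -> E) (e : E) :
  exists2 D : set E -> R, is_mean S D &
    forall A, (forall k, A (iter k S e)) -> D A = 1.
Proof.
have [U [UU oU]] := @ultraFilterLemma nat \oo _.
pose freq (A : set E) (L : nat) : R := (visits S A e L)%:R / L%:R.
have freq01 A L : 0 <= freq A L <= 1.
  rewrite /freq; case: L => [|L]; first by rewrite invr0 mulr0 lexx ler01.
  rewrite divr_ge0 //= ler_pdivrMr // mul1r ler_nat; exact: visits_le_length.
pose D (A : set E) := lim (freq A @ U).
have cD A : freq A @ U --> D A := @ultra_cvg _ _ _ _ UU (freq01 A).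
have cD_eq A l : freq A @ U --> l -> D A = l by move=> h; exact: cvg_lim.
exists D; first split.
- move=> A B AB; apply: ler_lim; [exact: cD|exact: cD|].
  apply: nearW => L; rewrite ler_wpM2r ?invr_ge0 // ler_nat.
  exact: visits_subset.
- move=> A B; rewrite -limD; [|exact: cD..].
  rewrite -limD; [|exact: cD..].
  congr lim; congr (_ @ U); apply/funext => L /=.
  by rewrite /= /freq !fctE -!mulrDl -!natrD visits_modular.
- apply: cD_eq; rewrite (_ : freq _ = cst 0); first exact: cvg_cst.
  by apply/funext => L; rewrite /freq visits_set0 mul0r.
- move=> A; apply: cD_eq.
  have -> : freq (S @^-1` A) = (fun L => freq A L + (freq (S @^-1` A) L - freq A L)).
    by apply/funext => L; rewrite addrC subrK.
  rewrite -[D A]addr0; apply: cvgD; first exact: cD.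
  apply/cvgrPdist_le => /= eps eps0; apply: oU.
  near=> L.
  have L0 : 0 < L%:R :> R by rewrite ltr0n; near: L; exists 1%N.
  have LR : (L%:R)^-1 <= eps.
    rewrite invf_ple ?posrE //; near: L; exact: nbhs_infty_ger.
  apply: le_trans LR; rewrite /freq -mulrBl sub0r normrN normrM.
  rewrite [X in _ * X]gtr0_norm ?invr_gt0 // ler_piMl ?invr_ge0 //.
  have := visits_preimage S A e L; move: (visits _ _ _ _) (visits _ _ _ _) => p q.
  move=> pq; have [->|[->|->]] : p = q \/ (p = q.+1 \/ q = p.+1).
  + by move: pq; case: (_ \in A); case: (_ \in A) => /=; lia.
  + by rewrite subrr normr0.
  + by rewrite -[q.+1%:R]natr1 opprD addrA subrr sub0r normrN normr1.
  + by rewrite -[p.+1%:R]natr1 addrAC subrr add0r normr1.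
- move=> A hA; apply: cD_eq; apply: (@cvg_trans _ ((fun=> 1 : R) @ U)); last exact: cvg_cst.
  apply: near_eq_cvg; apply: oU; exists 1%N => // L /= L0.
  by rewrite /freq visits_orbit // divff // pnatr_eq0 -lt0n.
Unshelve. all: by end_near. Qed.

(** The outer regularization of a mean: it plays the part of an invariant measure
    on closed sets, being continuous along decreasing neighbourhoods of a closed
    set, as countable additivity would provide. *)
Definition outer (R : realType) (E : topologicalType) (D : set E -> R)
    (C : set E) : R :=
  inf [set D O | O in [set O | open O /\ C `<=` O]].

Section Outer.
Variables (R : realType) (E : topologicalType) (S : E -> E) (D : set E -> R).
Hypotheses (cE : compact [set: E]) (hE : hausdorff_space E) (cS : continuous S).
Hypothesis mD : is_mean S D.
Implicit Types C O : set E.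

Let has_inf_outer C : has_inf [set D O | O in [set O | open O /\ C `<=` O]].
Proof.
split; first by exists (D setT); exists setT => //; split => //; exact: openT.
by exists 0; move=> _ [V _ <-]; exact: mean_ge0 mD.
Qed.

Lemma outer_le_open C O : open O -> C `<=` O -> outer D C <= D O.
Proof. by move=> oO CO; apply: ge_inf; [case: (has_inf_outer C)|exists O]. Qed.

Lemma outer_lub C a :
  (forall O, open O -> C `<=` O -> a <= D O) -> a <= outer D C.
Proof.
move=> h; apply: lb_le_inf; first by case: (has_inf_outer C).
by move=> _ [V [oV CV] <-]; exact: h.
Qed.

Lemma outer_approx C e : 0 < e ->
  exists O, [/\ open O, C `<=` O & D O < outer D C + e].
Proof.
move=> e0; have [_ [V [oV CV] <-] DO] := inf_adherent e0 (has_inf_outer C).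
by exists V.
Qed.

Lemma outer_subset C C' : C `<=` C' -> outer D C <= outer D C'.
Proof.
by move=> CC'; apply: outer_lub => O oO C'O; apply: outer_le_open => // x /CC' /C'O.
Qed.

Lemma open_le_outer C O : O `<=` C -> D O <= outer D C.
Proof.
by move=> OC; apply: outer_lub => V _ CV; apply: (mean_subset mD) => x /OC /CV.
Qed.

Lemma outer_set0 : outer D set0 = 0.
Proof.
apply/eqP; rewrite eq_le; apply/andP; split.
  by rewrite -(mean_set0 mD); apply: outer_le_open => //; exact: open0.
by apply: outer_lub => O _ _; exact: mean_ge0 mD.
Qed.

Lemma outer_preimage C C' : C `<=` S @^-1` C' -> outer D C <= outer D C'.
Proof.
move=> CC'; apply: outer_lub => O oO C'O; rewrite -(mean_preimage mD).
apply: outer_le_open => [|x /CC' /C'O //].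
by apply: open_comp => // x _; exact: cS.
Qed.

(** Normality of the space lets disjoint closed sets be separated: two open
    neighbourhoods of [C] and [C'] can be chosen with their intersection inside
    any prescribed neighbourhood of [C `&` C']. Modularity of [D] on these open
    sets gives the inequality. *)
Lemma outer_supermodular C C' : closed C -> closed C' ->
  outer D C + outer D C' <= outer D (C `|` C') + outer D (C `&` C').
Proof.
move=> cC cC'; apply/ler_addgt0Pr => e e0.
have e20 : 0 < e / 2 by rewrite divr_gt0.
have [P1 [oP1 CP1 D1]] := outer_approx (C `|` C') e20.
have [P2 [oP2 CP2 D2]] := outer_approx (C `&` C') e20.
have cK : closed (C `&` ~` P2) by apply: closedI => //; rewrite closedC.
have [|V nV cV] := @compact_normal _ hE cE _ cK (~` C') _.
  move=> x [Cx nO2x]; apply: open_nbhs_nbhs; split; first by rewrite openC.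
  by move=> C'x; apply: nO2x; exact: CP2.
have /set_nbhsP [W [oW KW WV]] := nV.
pose G := P1 `&` (W `|` P2); pose G' := P1 `&` ~` closure V.
have DG : outer D C <= D G.
  apply: outer_le_open; first by apply: openI => //; exact: openU.
  move=> x Cx; split; first by apply: CP1; left.
  by have [|nO2] := pselect (P2 x); [right|left; apply: KW].
have DG' : outer D C' <= D G'.
  apply: outer_le_open.
    by apply: openI => //; rewrite openC; exact: closed_closure.
  by move=> x Cx; split; [apply: CP1; right|move=> /cV].
have U1 : D (G `|` G') <= D P1 by apply: (mean_subset mD) => x [[]|[]].
have U2 : D (G `&` G') <= D P2.
  apply: (mean_subset mD) => x [[_ [Wx|//]] [_ nV']].
  by exfalso; apply: nV'; apply: subset_closure; exact: WV.
have := mean_modular mD G G'; lra.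
Qed.

End Outer.

(** * Equicontinuous factors from invariant pseudo-distances *)

Record pseudodist (R : realType) (X : choiceType) := Pseudodist {
  pdist :> X -> X -> R;
  pdistxx : forall x, pdist x x = 0;
  pdistC : forall x y, pdist x y = pdist y x;
  pdist_triangle : forall y x z, pdist x z <= pdist x y + pdist y z
}.

Section Separation.
Variables (R : realType) (X : choiceType) (f : pseudodist R X).

Lemma pdist_ge0 x y : 0 <= f x y.
Proof.
have := pdist_triangle f y x x; rewrite pdistxx (pdistC f y x); lra.
Qed.

Lemma pdist0_eq x y z : f x y = 0 -> f x z = f y z.
Proof.
move=> xy; have := pdist_triangle f y x z; have := pdist_triangle f x y z.
rewrite (pdistC f y x) xy; lra.
Qed.

Definition class_repr (x : X) : X := choose (fun y => f x y == 0) x.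

Lemma class_reprP x : f x (class_repr x) = 0.
Proof. by apply/eqP; apply: (@chooseP _ (fun y => f x y == 0)); rewrite pdistxx. Qed.

Lemma class_repr_eq x y : f x y = 0 -> class_repr x = class_repr y.
Proof.
move=> xy; rewrite /class_repr.
have -> : (fun z => f x z == 0) = (fun z => f y z == 0).
  by apply/funext => z; rewrite (pdist0_eq z xy).
by apply: choose_id; rewrite ?pdistxx // pdistC xy.
Qed.

(** The metric quotient identifying points at pseudo-distance 0, realized as the
    set of canonical representatives so that the distance is a restriction. *)
Definition separation : Type := {y : X | class_repr y == y}.
HB.instance Definition _ := Choice.on separation.

Definition separation_dist (u v : separation) : R := f (val u) (val v).

Lemma separation_dist_eq0 u v : separation_dist u v = 0 -> u = v.
Proof.
move=> /class_repr_eq; rewrite (eqP (valP u)) (eqP (valP v)).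
exact: val_inj.
Qed.

HB.instance Definition _ := @isMetric.Build R separation separation_dist
  (fun u => pdistxx f (val u)) separation_dist_eq0
  (fun u v => pdistC f (val u) (val v))
  (fun v u w => pdist_triangle f (val v) (val u) (val w)).

Lemma class_repr_subproof x : class_repr (class_repr x) == class_repr x.
Proof. by apply/eqP/esym/class_repr_eq/class_reprP. Qed.

Definition to_separation (x : X) : separation :=
  exist _ (class_repr x) (class_repr_subproof x).

Lemma to_separation_val u : to_separation (val u) = u.
Proof. by apply: val_inj; exact: (eqP (valP u)). Qed.

Lemma mdist_to_separation x y :
  mdist (to_separation x) (to_separation y) = f x y.
Proof.
transitivity (f (class_repr x) (class_repr y)); first by [].
rewrite -(pdist0_eq (class_repr y) (class_reprP x)) pdistC.
by rewrite -(pdist0_eq x (class_reprP y)) pdistC.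
Qed.

End Separation.

(** The quotient by a continuous nonexpanding pseudo-distance is an
    equicontinuous factor, on which the induced map is nonexpanding; by
    universality it factorizes through [pi]. Showing that two points of a fibre
    of [pi] behave alike thus reduces to finding a pseudo-distance. *)
Lemma nonexpanding_pseudodist_fiber (R : realType) (X Xeq : metricType R)
    (T : X -> X) (Teq : Xeq -> Xeq) (pi : X -> Xeq) (f : pseudodist R X) :
  is_system T -> is_max_equicontinuous_factor T Teq pi ->
  (forall x e, 0 < e -> \forall y \near x, f x y < e) ->
  (forall x y, f (T x) (T y) <= f x y) ->
  forall x y, pi x = pi y -> f x y = 0.
Proof.
move=> [[x0 _] cX cT sT] [_ _ _ univ] cf fT.
pose Z : metricType R := separation f.
pose psi : X -> Z := @to_separation _ _ f.
pose Q : Z -> Z := fun z => psi (T (val z)).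
have cpsi : continuous psi.
  move=> x V /nbhs_mdistP [e e0 eV].
  by apply: filterS (cf x e e0) => y xy; apply: eV; rewrite mdist_to_separation.
have psiT x : psi (T x) = Q (psi x).
  apply: mdist_positivity; rewrite mdist_to_separation; apply/eqP.
  rewrite eq_le pdist_ge0 andbT (le_trans (fT _ _)) //.
  by rewrite /psi /= class_reprP.
have dQ (u v : Z) : mdist (Q u) (Q v) <= mdist u v.
  by rewrite mdist_to_separation; exact: fT.
have dQm m (u v : Z) : mdist (iter m Q u) (iter m Q v) <= mdist u v.
  by elim: m => //= m IH; exact: le_trans (dQ _ _) IH.
have psi_surj z : exists x, psi x = z by exists (val z); exact: to_separation_val.
have sQ : is_system Q.
  split.
  - by exists (psi x0).
  - rewrite (_ : [set: Z] = psi @` [set: X]).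
      by apply: continuous_compact => //; exact: continuous_subspaceT.
    by apply/seteqP; split => // z _; have [x <-] := psi_surj z; exists x.
  - move=> z V /nbhs_mdistP [e e0 eV]; apply/nbhs_mdistP; exists e => // w zw.
    by apply: eV; exact: le_lt_trans (dQ _ _) zw.
  - apply/seteqP; split => // z _; have [x <-] := psi_surj z.
    have [x' _ <-] : range T x by rewrite sT.
    by exists (psi x') => //; rewrite psiT.
have eQ : is_equicontinuous Q.
  by move=> e e0; exists e => // u v uv m _; exact: le_lt_trans (dQm _ _ _) uv.
have [|phi _ psiE] := univ Z Q psi sQ eQ.
  by split => //; apply/seteqP; split => // z _; have [x <-] := psi_surj z; exists x.
move=> x y xy; rewrite -mdist_to_separation -/(psi x) -/(psi y) psiE /= xy.
by rewrite mdistxx.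
Qed.

(** * Sections of closed invariant sets over a fibre *)

Section MeanSyndetic.
Variables (R : realType) (E : Type) (S : E -> E) (D : set E -> R).
Hypothesis mD : is_mean S D.

Lemma mean_iter_preimage A j : D [set e | A (iter j S e)] = D A.
Proof.
elim: j => [//|j IH]; rewrite -IH -[RHS](mean_preimage mD); congr D.
by apply/seteqP; split => e /=; rewrite -iterS iterSr.
Qed.

(** If the translates of [A] up to [N] cover an orbit, the mean of [A] along it
    is at least [1 / (N + 1)]. *)
Lemma mean_hitting A N :
  D [set e | exists2 j, (j <= N)%N & A (iter j S e)] <= D A *+ N.+1.
Proof.
elim: N => [|N IH].
  by apply: (mean_subset mD) => e [j]; rewrite leqn0 => /eqP ->.
rewrite mulrS addrC; apply: (le_trans _ (lerD IH (lexx (D A)))).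
rewrite -(mean_iter_preimage A N.+1).
set B := [set e | exists2 j, (j <= N)%N & _]; set C := [set e | A _].
have : D [set e | exists2 j, (j <= N.+1)%N & A (iter j S e)] <= D (B `|` C).
  apply: (mean_subset mD) => e [j jN Aj].
  have [jN'|jN'] := leqP j N; first by left; exists j.
  have jE : j = N.+1 by lia.
  by right; move: Aj; rewrite jE.
have := mean_modular mD B C; have := mean_ge0 (B `&` C) mD; lra.
Qed.

End MeanSyndetic.

Section FiberTransfer.
Variables (R : realType) (X Xeq : metricType R) (T : X -> X).
Variables (Teq : Xeq -> Xeq) (pi : X -> Xeq).
Hypotheses (hT : is_minimal T) (hpi : is_max_equicontinuous_factor T Teq pi).
Variables (E : topologicalType) (S : E -> E).
Hypotheses (cE : compact [set: E]) (hE : hausdorff_space E) (cS : continuous S).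
Variable N : X -> set E.
Hypothesis cN : closed [set p : X * E | N p.1 p.2].
Hypothesis iN : forall x e, N x e -> N (T x) (S e).

(** Tube lemma: the complement of [O] is compact and the graph of [N] closed. *)
Lemma section_upper_semicontinuous x O :
  open O -> N x `<=` O -> \forall y \near x, N y `<=` O.
Proof.
move=> oO NO.
have /compact_near_coveringP cO : compact (~` O).
  by apply: subclosed_compact cE _ => //; rewrite closedC.
have := cO _ (nbhs x) (fun y e => ~ N y e) _.
move=> /(_ _) H.
have {H} : \forall y \near x, ~` O `<=` (fun e => ~ N y e).
  apply: H => e nOe.
  have : nbhs (x, e) (~` [set p : X * E | N p.1 p.2]).
    by apply: open_nbhs_nbhs; split; [rewrite openC|move=> /NO].
  move=> [[A B] /= [xA eB] AB]; exists (B, A) => // -[e' x'] /= [Be Ax].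
  exact: (AB (x', e')).
by apply: filterS => y h e Ne; apply: contrapT => /h.
Qed.

Lemma section_closed x : closed (N x).
Proof.
have -> : N x = (fun e => (x, e)) @^-1` [set p : X * E | N p.1 p.2] by [].
by apply: preimage_closed => // e _; apply: cvg_pair; [exact: cvg_cst|exact: cvg_id].
Qed.

Section WithMean.
Variable D : set E -> R.
Hypothesis mD : is_mean S D.

Let m := outer D.

(** The function [fun x => m (N x)] is upper semicontinuous and does not decrease
    along orbits, so each of its upper level sets is closed and invariant, hence
    empty or everything. *)
Lemma outer_section_const x y : m (N x) = m (N y).
Proof.
suff h z w : m (N z) <= m (N w) by apply/eqP; rewrite eq_le !h.
pose A := [set v | m (N z) <= m (N v)].
suff : A = setT by move=> AT; have : A w by rewrite AT.
have [_ minT] := hT; apply: minT; last 2 first.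
- by exists z; exact: lexx.
- move=> _ [v Av <-]; apply: le_trans Av _.
  by apply: (outer_preimage cS mD) => e; exact: iN.
rewrite -openC openE => v /= /negP; rewrite -ltNge => mv.
have [V [oV NV DV]] := outer_approx mD (N v) (e := m (N z) - m (N v)) ltac:(by rewrite subr_gt0).
rewrite /interior; apply: filterS (section_upper_semicontinuous oV NV) => u NuV.
apply/negP; rewrite -ltNge; apply: le_lt_trans (outer_le_open mD oV NuV) _.
by move: DV; rewrite /m; lra.
Qed.

(* Since [m (N x)] is constant, this plays the part of half the measure of the
   symmetric difference of the sections. *)
Let d x y : R := m (N x) - m (N x `&` N y).

Let dxx x : d x x = 0. Proof. by rewrite /d setIid subrr. Qed.

Let dC x y : d x y = d y x.
Proof. by rewrite /d setIC (outer_section_const x y). Qed.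

Let d_triangle y x z : d x z <= d x y + d y z.
Proof.
have cI u v : closed (N u `&` N v) by apply: closedI; exact: section_closed.
have := outer_supermodular cE hE mD (cI x y) (cI y z).
have : m ((N x `&` N y) `|` (N y `&` N z)) <= m (N y).
  by apply: (outer_subset mD) => e [[]|[]].
have : m ((N x `&` N y) `&` (N y `&` N z)) <= m (N x `&` N z).
  by apply: (outer_subset mD) => e [[? ?] [? ?]].
rewrite /d (outer_section_const y x) /m; lra.
Qed.

(** The pseudo-distance [d] is nonexpanding because
    [N x `&` N y] is contained in the preimage of [N (T x) `&` N (T y)], and
    continuous because sections close to [N x] lie in a small neighbourhood of
    it while having the same outer mean. *)
Lemma outer_fiber x y : pi x = pi y -> m (N x `&` N y) = m (N x).
Proof.
move=> xy; pose f := Pseudodist dxx dC d_triangle.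
suff : f x y = 0 by rewrite /f /= /d; lra.
apply: (nonexpanding_pseudodist_fiber hT.1 hpi) xy => [u e e0|u v] /=.
  have [V [oV NV DV]] := outer_approx mD (N u) e0.
  apply: filterS (section_upper_semicontinuous oV NV) => v NvV.
  have := outer_supermodular cE hE mD (section_closed (x := u)) (section_closed (x := v)).
  have := outer_section_const v u.
  have : m (N u `|` N v) <= D V by apply: (outer_le_open mD oV) => e' [/NV|/NvV].
  rewrite /d /m; lra.
rewrite /d (outer_section_const (T u) u) lerD2l lerN2.
by apply: (outer_preimage cS mD) => e [Nu Nv]; split; exact: iN.
Qed.

End WithMean.

(** Over a fibre of [pi] the sections coincide up to sets of outer mean 0, for
    every mean. A point of [H] outside [N y] would have a neighbourhood inside
    [N x] missing [N y], which the mean along an orbit visiting it with bounded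
    gaps does not neglect. *)
Lemma fiber_transfer (H : set E) x y :
  (forall V : set E, open V -> V !=set0 -> exists e k,
    forall i, exists2 j, (j <= k)%N & V (iter j S (iter i S e))) ->
  pi x = pi y -> open H -> H `<=` N x -> H `<=` N y.
Proof.
move=> syn xy oH HN h Hh; apply: contrapT => nNh.
have ch : closed [set h] by apply/accessible_closed_set1/hausdorff_accessible.
have [|V nV cV] := @compact_normal _ hE cE _ ch (H `&` ~` N y) _.
  move=> _ ->; apply: open_nbhs_nbhs; split => //.
  by apply: openI => //; rewrite openC; exact: section_closed.
have Vh : V^° h by apply: nV.
have [e [k ek]] := syn V^° (@open_interior _ _) (ex_intro _ h Vh).
have [D mD D1] := exists_orbit_mean R S e.
have DV : 1 <= D V^° *+ k.+1.
  rewrite -(D1 [set u | exists2 j, (j <= k)%N & V^° (iter j S u)] ek).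
  exact: mean_hitting.
have mV : D V^° <= outer D (closure V).
  by apply: (open_le_outer mD) => u /interior_subset; exact: subset_closure.
have := outer_supermodular cE hE mD (closedI (section_closed (x := x)) (section_closed (x := y)))
  (@closed_closure _ V).
rewrite (outer_fiber mD xy).
have -> : (N x `&` N y) `&` closure V = set0.
  by apply/seteqP; split => // u [[_ Nu] /cV [_]].
rewrite (outer_set0 mD).
have : outer D ((N x `&` N y) `|` closure V) <= outer D (N x).
  by apply: (outer_subset mD) => u [[//]|/cV [/HN]].
have : 0 < D V^°.
  rewrite lt_neqAle (mean_ge0 _ mD) andbT; apply/eqP => D0.
  by move: DV; rewrite -D0 mul0rn ler10.
lra.
Qed.

End FiberTransfer.

(** * From a recurrent tuple in a fibre to broken sensitivity *)

Section Minimal.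
Variables (R : realType) (X : metricType R) (T : X -> X).
Hypothesis hT : is_minimal T.

Lemma minimal_set_setT : minimal_set T [set: X].
Proof.
have [sT minT] := hT; split=> //; first exact: system_nonempty sT.
move=> M' cM' M0 iM' _; rewrite (minT M') // => _ [x Mx <-]; exact: iM'.
Qed.

Lemma dense_orbit (G : set X) x : open G -> G !=set0 ->
  exists j, G (iter j T x).
Proof.
move=> oG G0; apply: (minimal_set_hits _ minimal_set_setT) => //.
  exact: system_continuous hT.1.
by rewrite setTI.
Qed.

(** Shifting the coordinates of a point of a minimal set of the product by
    different times commutes with the product map, so preserves the bounded
    gaps, and brings each coordinate close to a prescribed place. *)
Lemma syndetic_points_dense n (V : set {ptws 'I_n -> X}) :
  open V -> V !=set0 -> exists e k, forall i, exists2 j, (j <= k)%N &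
    V (iter j (@prod_map n X T) (iter i (@prod_map n X T) e)).
Proof.
move=> oV [v Vv]; have sT := hT.1; have cT := system_continuous sT.
have cE := ptws_compact (n := n) (system_compact sT).
have cS := prod_map_continuous (n := n) cT.
have [x0 _] := system_nonempty sT.
have [//||//|M mM _] := @exists_minimal_set {ptws 'I_n -> X} (@prod_map n X T) setT cE.
  by exists (fun _ => x0).
have [_ [u Mu] iM _] := mM.
have /ptws_nbhsP [d d0 dV] : nbhs v V by apply: open_nbhs_nbhs.
have /choice [a ha] : forall i : 'I_n, exists a, mdist (v i) (iter a T (u i)) < d.
  move=> i; apply: (@dense_orbit [set y | mdist (v i) y < d]).
    by apply: open_mdist_lt => y; [exact: cvg_cst|exact: cvg_id].
  by exists (v i); rewrite /= mdistxx.
pose shift (w : {ptws 'I_n -> X}) : {ptws 'I_n -> X} := fun i => iter (a i) T (w i).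
have cshift : continuous shift.
  apply: ptws_continuous => i w.
  exact: (@ptws_coord_comp_continuous _ _ _ _ (iter (a i) T) i (@continuous_iter _ _ cT (a i)) w).
have shiftS w j : iter j (@prod_map n X T) (shift w) = shift (iter j (@prod_map n X T) w).
  by apply/funext => i; rewrite /shift !iter_prod_map -!iterD addnC.
have oG : open (shift @^-1` V) by apply: open_comp => // w _; exact: cshift.
have [|k hk] := minimal_set_syndetic cE cS mM oG.
  by exists u; split => //; apply: dV => i; exact: ha.
exists (shift u), k => i.
have [j jk Vj] := hk _ (forward_invariant_iter i iM Mu).
by exists j => //; rewrite !shiftS.
Qed.

Section Factor.
Variables (Xeq : metricType R) (Teq : Xeq -> Xeq) (pi : X -> Xeq).

(** Finitely many preimages of a closed set inside [U] cover [X]; their images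
    are finitely many closed sets covering [Xeq], one of which has interior. *)
Lemma factor_semi_open (U : set X) :
  is_factor_map T Teq pi -> open U -> U !=set0 ->
  exists i (J : set Xeq), [/\ open J, J !=set0 &
    forall y, J y -> exists2 x, U (iter i T x) & pi x = y].
Proof.
move=> [cpi spi _] oU [x0 Ux0]; have sT := hT.1; have cT := system_continuous sT.
have /nbhs_mdistP [d d0 dU] : nbhs x0 U by apply: open_nbhs_nbhs.
pose C := ~` [set x | d / 2 < mdist x0 x].
have cC : closed C.
  by rewrite /C closedC; apply: open_mdist_gt => y; [exact: cvg_cst|exact: cvg_id].
have CU : C `<=` U.
  move=> x /negP; rewrite -leNgt => h; apply: dU; apply: le_lt_trans h _; lra.
have [||N hN] := minimal_set_syndetic (G := [set x | mdist x0 x < d / 2])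
  (system_compact sT) cT minimal_set_setT.
- by apply: open_mdist_lt => y; [exact: cvg_cst|exact: cvg_id].
- by exists x0; split => //=; rewrite mdistxx divr_gt0.
have [||||i _ [J [oJ J0 JC]]] := @closed_seq_cover_interior Xeq nat
    (fun i => pi @` [set x | C (iter i T x)]) (iota 0 N.+1) setT.
- move=> i; apply: compact_closed; first exact: metric_hausdorff.
  apply: continuous_compact; first exact: continuous_subspaceT.
  by apply: subclosed_compact (system_compact sT) _ => //; exact: closed_iter.
- exact: openT.
- by exists (pi x0).
- move=> y _; have [x _ <-] : range pi y by rewrite spi.
  have [j jN Bj] := hN x Logic.I; exists j; first by rewrite mem_iota.
  exists x => //=; apply/negP; rewrite -leNgt; exact: ltW.
exists i, J; split => // y /JC [x Cx <-]; exists x => //; exact: CU.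
Qed.

Hypothesis hpi : is_max_equicontinuous_factor T Teq pi.
Variable n : nat.

(** The constraint of lying in [U] is traded for that of lying over [J] one
    coordinate at a time. For the coordinate being changed, [N0] is seen as a
    family of closed sets indexed by the value of this coordinate, and
    [fiber_transfer] moves a value in [U] to any value of the same fibre. *)
Lemma closed_invariant_saturated (N0 : set {ptws 'I_n -> X}) (U : set X)
    (J : set Xeq) :
  closed N0 -> forward_invariant (@prod_map n X T) N0 -> open U -> open J ->
  (forall y, J y -> exists2 x, U x & pi x = y) ->
  (forall e : {ptws 'I_n -> X}, (forall i, U (e i)) -> N0 e) ->
  forall e : {ptws 'I_n -> X}, (forall i, J (pi (e i))) -> N0 e.
Proof.
move=> cN0 iN0 oU oJ JU UN.
have sT := hT.1; have cT := system_continuous sT.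
have [_ _ [cpi _ _] _] := hpi.
have cE := ptws_compact (n := n) (system_compact sT).
have cS := prod_map_continuous (n := n) cT.
suff H k : (k <= n)%N -> forall e : {ptws 'I_n -> X},
    (forall i : 'I_n, if (i < k)%N then J (pi (e i)) else U (e i)) -> N0 e.
  by move=> e eJ; apply: (H n) => // i; rewrite ltn_ord.
elim: k => [_ e eU|k IH kn e eJ]; first exact: UN.
pose c := Ordinal kn.
pose upd (x : X) (w : {ptws 'I_n -> X}) : {ptws 'I_n -> X} :=
  fun i => if i == c then x else w i.
have cupd : continuous (fun p : X * {ptws 'I_n -> X} => upd p.1 p.2).
  apply: ptws_continuous => i p; rewrite /upd; case: eqP => _; first exact: cvg_fst.
  apply: (@continuous_comp _ _ _ snd (fun w : {ptws 'I_n -> X} => w i)).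
    exact: cvg_snd.
  exact: ptws_coord_continuous.
pose H : set {ptws 'I_n -> X} :=
  [set w | forall i : 'I_n, i != c -> if (i < k)%N then J (pi (w i)) else U (w i)].
have oH : open H.
  apply: open_forall => i; apply: open_imply => _; case: (i < k)%N.
    apply: (@open_comp _ _ (fun w : {ptws 'I_n -> X} => pi (w i))) => // w _.
    exact: ptws_coord_comp_continuous.
  by apply: open_comp => // w _; exact: ptws_coord_continuous.
have [z Uz zc] : exists2 x, U x & pi x = pi (e c).
  by apply: JU; have := eJ c; rewrite /= ltnSn.
have HN : H `<=` [set w | N0 (upd z w)].
  move=> w Hw; apply: IH; first exact: ltnW.
  move=> i; rewrite /upd; case: eqVneq => [->|ic]; first by rewrite /= ltnn.
  exact: Hw.
have := @fiber_transfer R X Xeq T Teq pi hT hpi {ptws 'I_n -> X} (@prod_map n X T)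
  cE (@ptws_hausdorff _ _ _) cS (fun x => [set w | N0 (upd x w)]) _ _ H z (e c)
  (@syndetic_points_dense n) zc oH HN e.
have updE : upd (e c) e = e by apply/funext => i; rewrite /upd; case: eqP => [->|].
rewrite /= updE; apply.
- by apply: (@preimage_closed _ _ (fun p : X * {ptws 'I_n -> X} => upd p.1 p.2)) => // p _; exact: cupd.
- move=> x w Nw; have := iN0 _ Nw; congr N0.
  by apply/funext => i; rewrite /upd /prod_map; case: eqP.
- move=> i ic; have := eJ i; rewrite ltnS leq_eqVlt.
  by have -> : (i == k :> nat) = false by apply/negbTE.
Qed.

(** Apply [closed_invariant_saturated] to the closure of the forward orbit of the
    tuples with coordinates in [U]. *)
Lemma fiber_hitting (U : set X) (V : set {ptws 'I_n -> X}) (J : set Xeq)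
    (u : {ptws 'I_n -> X}) :
  open U -> open J -> (forall y, J y -> exists2 x, U x & pi x = y) ->
  (forall i, J (pi (u i))) -> nbhs u V ->
  exists t (e : {ptws 'I_n -> X}), (forall i, U (e i)) /\
    V (iter t (@prod_map n X T) e).
Proof.
move=> oU oJ JU Ju Vu.
have cS := prod_map_continuous (n := n) (system_continuous hT.1).
pose B := [set w | exists t (e : {ptws 'I_n -> X}),
  (forall i, U (e i)) /\ w = iter t (@prod_map n X T) e].
have : closure B u.
  apply: (closed_invariant_saturated (U := U) (J := J)) => //.
  - exact: closed_closure.
  - move=> w clw W /cS /clw [_ [[t [e [Ue ->]]] We]].
    by exists (iter t.+1 (@prod_map n X T) e); split => //; exists t.+1, e.
  - by move=> e Ue; apply: subset_closure; exists 0%N, e.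
by move=> /(_ V Vu) [_ [[t [e [Ue ->]]] Ve]]; exists t, e.
Qed.

(** By [factor_semi_open] the fibre of the tuple enters, at some time [r], an
    open set covered by a preimage [iter i0 T] of [U]; tuples of [U] then reach
    any neighbourhood of the tuple at time [r]. Recurrence provides a later time
    [k] at which the tuple is back at a place following the pattern of its own
    orbit during the first [l] steps. *)
Lemma recurrent_fiber_broken_sensitive (F : set (set nat)) y
    (x : {ptws 'I_n -> X}) :
  (0 < n)%N ->
  (forall A, F A -> forall k, exists2 p, (k <= p)%N & A p) ->
  (forall i j : 'I_n, i <> j -> x i <> x j) -> (forall i, pi (x i) = y) ->
  recurrent_point F (@prod_map n X T) x -> broken_sensitive F n T.
Proof.
move=> n0 Funb xinj xy recx; have cT := system_continuous hT.1.
have cS := prod_map_continuous (n := n) cT.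
have fpi : is_factor_map T Teq pi by case: hpi.
have [_ _ piT] := fpi.
have [d [d0 dx]] : exists d : R, 0 < d /\ forall i j : 'I_n, i <> j -> d < mdist (x i) (x j).
  pose m := \big[Num.min/1]_(p : 'I_n * 'I_n | p.1 != p.2) mdist (x p.1) (x p.2).
  have m0 : 0 < m.
    apply: lt_bigmin => // p pn; rewrite mdist_gt0; apply/eqP; apply: xinj.
    exact/eqP.
  exists (m / 2); split; first by rewrite divr_gt0.
  move=> i j ij; apply: (@lt_le_trans _ _ m); first lra.
  by apply: (@bigmin_le_cond _ _ _ _ (i, j)) => /=; apply/eqP.
pose G : set {ptws 'I_n -> X} :=
  [set e | forall p : 'I_n * 'I_n, p.1 != p.2 -> d < mdist (e p.1) (e p.2)].
have oG : open G.
  apply: open_forall => p; apply: open_imply => _.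
  by apply: open_mdist_gt; exact: ptws_coord_continuous.
have Gx : G x by move=> p /eqP pn; exact: dx.
exists d; split=> //; exists [set k | G (iter k (@prod_map n X T) x)].
  by apply: recx; exact: open_nbhs_nbhs.
move=> U oU U0 l l0.
pose V : set {ptws 'I_n -> X} := [set e | forall p : 'I_l.+1,
  G (iter p (@prod_map n X T) x) -> G (iter p (@prod_map n X T) e)].
have oV : open V.
  by apply: open_forall => p; apply: open_imply => _; exact: open_iter.
have [i0 [J [oJ J0 JU]]] := factor_semi_open fpi oU U0.
have [r Jr] : exists r, J (pi (iter r T (x (Ordinal n0)))).
  have [y' Jy'] := J0; have [x' _ x'y] := JU _ Jy'.
  apply: (@dense_orbit (pi @^-1` J)); last by exists x'; rewrite /= x'y.
  by apply: open_comp => // z _; case: fpi.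
have piTr k z : pi (iter k T z) = iter k Teq (pi z).
  by elim: k => //= k IH; rewrite piT IH.
have Jx i : J (pi (iter r (@prod_map n X T) x i)).
  by rewrite iter_prod_map piTr xy -(xy (Ordinal n0)) -piTr.
have [k rk Vk] := Funb _ (recx V (open_nbhs_nbhs (conj oV (fun p h => h)))) (r + i0)%N.
have [||t [e [Ue Ve]]] := @fiber_hitting [set z | U (iter i0 T z)]
    [set e | V (iter (k - r) (@prod_map n X T) e)] J
    (iter r (@prod_map n X T) x) _ oJ JU Jx _.
- exact: open_iter.
- apply: open_nbhs_nbhs; split; first exact: open_iter.
  by rewrite /= -iterD subnK //; lia.
exists (fun i => iter i0 T (e i)), (k - r + t - i0)%N; split=> // p Gp pl i j ij.
have pl' : (p < l.+1)%N by lia.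
have := Ve (Ordinal pl') Gp (i, j) _; rewrite /= => /(_ _).
rewrite -!iterD !iter_prod_map.
have -> : (p + (k - r) + t = k - r + t - i0 + p + i0)%N by lia.
by apply; apply/eqP => h; move: ij; rewrite h ltnn.
Qed.

End Factor.
End Minimal.

(** * Recurrence from piecewise syndetic visits *)

Section PiecewiseSyndetic.
Variables (E : topologicalType) (S : E -> E).
Hypotheses (cE : compact [set: E]) (cS : continuous S).

Lemma F_ps_unbounded A : F_ps A -> forall k, exists2 p, (k <= p)%N & A p.
Proof.
move=> [B [C [tB [N N1 sC] ->]]] k.
have [m m1 Bm] := tB (k + N).+1 isT.
have [j jm Cj] := sC (m + k)%N (ltn_addr _ m1).
exists j; first lia.
by split => //; apply: Bm; lia.
Qed.

(** Moving along the thick part of [A] and using compactness, one finds points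
    all of whose iterates come into [W] within [N] steps. They form a closed
    invariant set, and a minimal set inside it meets [W]. *)
Lemma F_ps_visits_recurrent (W : set E) (A : set nat) z :
  closed W -> F_ps A -> (forall p, A p -> (1 <= p)%N -> W (iter p S z)) ->
  exists2 u, W u & recurrent_point F_ps S u.
Proof.
move=> cW [B [C [tB [N N1 sC] AE]]] Wz.
pose K l := [set y | forall k, (k <= l)%N -> exists2 j, (j <= N)%N & W (iter j S (iter k S y))].
pose hit := [set y | exists2 j, (j <= N)%N & W (iter j S y)].
have chit : closed hit.
  have [s sE] : exists s : seq nat, forall j, (j \in s) = (j <= N)%N.
    by exists (iota 0 N.+1) => j; rewrite mem_iota.
  have -> : hit = \big[setU/set0]_(j <- s) [set y | W (iter j S y)].
    apply/seteqP; split => y; rewrite -bigcup_seq /=.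
      by move=> [j jN Wj]; exists j => //=; rewrite sE.
    by move=> [j /=]; rewrite sE => jN Wj; exists j.
  by apply: closed_bigsetU => j _; exact: closed_iter.
have KE l : K l = \bigcap_(k in [set k | (k <= l)%N]) [set y | hit (iter k S y)].
  by apply/seteqP; split.
have cK l : closed (K l) by rewrite KE; apply: closed_bigI => k _; exact: closed_iter.
have K0 l : K l !=set0.
  have [m m1 Bm] := tB (l + N).+1 isT.
  exists (iter m S z) => k kl.
  have [j jm Cj] := sC (m + k)%N (ltn_addr _ m1).
  exists (j - (m + k))%N; first lia.
  rewrite -!iterD; have -> : (j - (m + k) + k + m = j)%N by lia.
  by apply: Wz; [rewrite AE; split => //; apply: Bm; lia|lia].
have [y Ky] := compact_bigcap_nonempty cE cK K0 (fun l w Kw k kl => Kw k (leqW kl)).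
pose Kinf := \bigcap_l K l.
have [|||M mM MK] := @exists_minimal_set E S Kinf cE.
- by apply: closed_bigI => l _; exact: cK.
- by exists y => l _; exact: Ky.
- move=> w Kw l _ k kl; have [j jN Wj] := Kw l.+1 Logic.I k.+1 kl.
  by exists j => //; move: Wj; rewrite [in X in X -> _]iterSr.
have [_ [w Mw] iM _] := mM.
have [j jN Wu] := MK _ Mw 0%N Logic.I 0%N isT.
exists (iter j S w) => // V /nbhs_interior Vu.
have Mu := forward_invariant_iter j iM Mw.
have [|k hk] := minimal_set_syndetic cE cS mM (@open_interior _ V).
  by exists (iter j S w); split => //; exact: nbhs_singleton.
exists setT, [set i | V (iter i S (iter j S w))]; split; last by rewrite setTI.
  by move=> l l1; exists 1%N.
exists k.+1 => // i i1.
have [j' j'k Vj'] := hk _ (forward_invariant_iter i iM Mu).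
exists (j' + i)%N; first lia.
by rewrite /= iterD; exact: interior_subset.
Qed.

End PiecewiseSyndetic.

(** * Recurrence from visits of positive density *)

Section LargeSets.
Variables (E : topologicalType) (S : E -> E).
Hypotheses (cE : compact [set: E]) (cS : continuous S).
Implicit Types P : set E.

Definition often_large q P := forall L0, exists L y,
  (L0 <= L)%N /\ (L <= q * visits S P y L)%N.

(** For closed [P] this says that some invariant measure gives [P] mass at least
    [1 / q]. *)
Definition large q P := forall L, exists y, (L <= q * visits S P y L)%N.

(** Were every block of length [L] visited rarely, so would be every long
    orbit segment, being cut into such blocks. *)
Lemma often_large_large q P : often_large q P -> large (2 * q) P.
Proof.
move=> lP L; apply: contrapT => nL.
have small y : (2 * q * visits S P y L < L)%N.
  by rewrite ltnNge; apply/negP => h; apply: nL; exists y.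
have blocks a y : (2 * q * visits S P y (a * L) <= a * L)%N.
  elim: a y => [|a IH] y; first by rewrite mul0n visits0 muln0.
  rewrite mulSn visits_add mulnDr; apply: leq_add; first exact: ltnW.
  exact: IH.
have L0 : (0 < L)%N by have [M [y _]] := lP 0%N; have := small y; lia.
have [M [y [ML h]]] := lP (2 * q * L).+1.
have := blocks (M %/ L)%N y.
have := divn_eq M L; have := ltn_pmod M L0.
set a := (M %/ L)%N; set r := (M %% L)%N => rL ME ha.
move: h; rewrite {2}ME visits_add.
have := visits_le_length S P (iter (a * L) S y) r.
move: (visits _ _ _ r) (visits _ _ _ (a * L)) ha => v w ha vr h.
have : (q * v <= q * L)%N by rewrite leq_mul2l; lia.
lia.
Qed.

Lemma visits_upper_semicontinuous P L y : closed P ->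
  \forall y' \near y, (visits S P y' L <= visits S P y L)%N.
Proof.
move=> cP; elim: L => [|L IH]; first by apply: nearW => y'; rewrite !visits0.
have [Py|nPy] := pselect (P (iter L S y)).
  apply: filterS IH => y'; rewrite !visitsSr (mem_set Py) => h.
  by apply: leq_add => //; case: (_ \in _).
have nP : nbhs y [set y' | (~` P) (iter L S y')].
  apply: open_nbhs_nbhs; split => //; apply: open_iter => //.
  by rewrite openC.
apply: filterS2 IH nP => y' h nPy'; rewrite !visitsSr.
by rewrite (memNset nPy') addn0; apply: leq_trans h _; rewrite leq_addr.
Qed.

Lemma closed_often_visiting q P L :
  closed P -> closed [set y | (L <= q * visits S P y L)%N].
Proof.
move=> cP; rewrite -openC openE => y /= /negP; rewrite -ltnNge => h.
rewrite /interior; apply: filterS (visits_upper_semicontinuous L y cP) => y' hy'.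
apply/negP; rewrite -ltnNge; apply: leq_ltn_trans h.
by rewrite leq_mul2l hy' orbT.
Qed.

(** At a point of the intersection of the closed sets of good starting points,
    the visit counts before time [L], a non-increasing sequence of integers,
    stabilize on the count for the intersection. *)
Lemma large_bigcap q (P : nat -> set E) :
  (forall j, closed (P j)) -> (forall j, P j.+1 `<=` P j) ->
  (forall j, large q (P j)) -> large q (\bigcap_j P j).
Proof.
move=> cP dP lP L.
have [y hy] := compact_bigcap_nonempty cE
  (fun j => @closed_often_visiting q (P j) L (cP j)) (fun j => lP j L)
  (fun j w hw => leq_trans hw (leq_mul (leqnn q) (visits_subset S w L (dP j)))).
have mP i j : (i <= j)%N -> P j `<=` P i.
  elim: j => [|j IH]; first by rewrite leqn0 => /eqP ->.
  by rewrite leq_eqVlt => /predU1P[->//|ij]; apply: subset_trans (IH ij).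
suff [j hj] : exists j, (visits S (P j) y L <= visits S (\bigcap_j P j) y L)%N.
  exists y; apply: leq_trans (hy j) _; exact: leq_mul.
elim: {hy} L => [|L [j hj]]; first by exists 0%N; rewrite !visits0.
have [Py|nPy] := pselect ((\bigcap_j P j) (iter L S y)).
  exists j; rewrite !visitsSr (mem_set Py); apply: leq_add => //.
  by case: (_ \in _).
have [i nPi] : exists i, ~ P i (iter L S y).
  by apply: contrapT => h; apply: nPy => i _; apply: contrapT => ?; apply: h; exists i.
exists (maxn i j); rewrite !visitsSr (memNset (A := P (maxn i j))).
  rewrite addn0; apply: leq_trans (leq_addr _ _); apply: leq_trans hj.
  by apply: visits_subset; apply: mP; exact: leq_maxr.
by move=> /mP h; apply: nPi; apply: h; exact: leq_maxl.
Qed.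

Definition good_upto q P j :=
  [set y | P y /\ forall L, (L <= j)%N -> (L <= 2 * q * visits S P y L)%N].

(** The analogue of density points. The frequency required is half of the one
    which [large q P] provides, so that the points which fail it account for half
    of the visits at most. *)
Definition good q P :=
  [set y | P y /\ forall L, (L <= 2 * q * visits S P y L)%N].

(** A maximal inequality: each visit to a bad point opens an interval of length
    at most [j] with few visits, and disjoint such intervals, chosen greedily
    from the left, contain all bad visits; only the last one may overshoot
    [M]. *)
Lemma bad_visits q P j y M :
  (2 * q * visits S (P `\` good_upto q P j) y M <= M + 2 * q * j)%N.
Proof.
elim/ltn_ind: M y => -[|M] IH y; first by rewrite visits0 muln0.
have [[Py bad]|nbad] := pselect ((P `\` good_upto q P j) y); last first.
  by rewrite visitsS (memNset nbad) add0n; apply: leq_trans (IH _ _ _) _.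
have [L [Lj hL]] : exists L, (L <= j)%N /\ (2 * q * visits S P y L < L)%N.
  apply: contrapT => h; apply: bad; split => // L Lj; rewrite leqNgt.
  by apply/negP => hL; apply: h; exists L.
have [LM|LM] := leqP L M.+1; last first.
  apply: leq_trans (leq_addl _ _); rewrite leq_mul2l; apply/orP; right.
  by apply: leq_trans (visits_le_length _ _ _ _) _; lia.
have := IH (M.+1 - L)%N _ (iter L S y).
have -> : visits S (P `\` good_upto q P j) y M.+1 =
  (visits S (P `\` good_upto q P j) y L +
   visits S (P `\` good_upto q P j) (iter L S y) (M.+1 - L))%N.
  by rewrite -visits_add subnKC.
have : (visits S (P `\` good_upto q P j) y L <= visits S P y L)%N.
  by apply: visits_subset => w [].
move=> h1 /(_ _) h2; rewrite mulnDr.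
have : (2 * q * visits S (P `\` good_upto q P j) y L < L)%N.
  by apply: leq_ltn_trans hL; rewrite leq_mul2l h1 orbT.
have := h2 ltac:(lia); lia.
Qed.

Lemma closed_good_upto q P j : closed P -> closed (good_upto q P j).
Proof.
move=> cP; have -> : good_upto q P j = P `&`
    \bigcap_(L in [set L | (L <= j)%N]) [set y | (L <= 2 * q * visits S P y L)%N].
  by apply/seteqP; split => y [Py h]; split.
by apply: closedI => //; apply: closed_bigI => L _; exact: closed_often_visiting.
Qed.

(** By [bad_visits] the points which are good up to a given time receive half of
    the visits, up to a bounded error; [large_bigcap] passes to all times. *)
Lemma large_good q P : closed P -> large q P ->
  closed (good q P) /\ large (8 * q) (good q P).
Proof.
move=> cP lP.
have -> : good q P = \bigcap_j good_upto q P j.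
  apply/seteqP; split => [y [Py h] j _|y h]; first by split.
  have [Py _] := h 0%N Logic.I; split => // L.
  by have [_ hL] := h L Logic.I; exact: hL.
have cG j := @closed_good_upto q P j cP.
split; first by apply: closed_bigI => j _.
apply: large_bigcap => // [j y [Py h]|j].
  by split => // L Lj; apply: h; exact: leqW.
have -> : (8 * q = 2 * (4 * q))%N by rewrite mulnA.
apply: often_large_large => L0.
pose L := (L0 + 4 * q * j)%N; have [y hy] := lP L.
exists L, y; split; first by rewrite leq_addr.
have := bad_visits q P j y L.
have vgb : (visits S P y L <= visits S (good_upto q P j) y L +
                          visits S (P `\` good_upto q P j) y L)%N.
  rewrite -visits_modular; apply: leq_trans (leq_addr _ _).
  by apply: visits_subset => w Pw; have [g|g] := pselect (good_upto q P j w); [left|right].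
have := leq_mul (leqnn q) vgb; rewrite mulnDr.
have : (4 * q * j <= L)%N by rewrite leq_addl.
lia.
Qed.

Lemma large_subset q P P' : P `<=` P' -> large q P -> large q P'.
Proof.
move=> PP' lP L; have [y hy] := lP L; exists y; apply: leq_trans hy _.
by rewrite leq_mul2l visits_subset ?orbT.
Qed.

Lemma large_pigeonhole (I : eqType) (s : seq I) (C : I -> set E) q P :
  large q P -> (forall y, P y -> exists2 i, i \in s & C i y) ->
  exists i q', large q' (P `&` C i).
Proof.
elim: s q P => [|i s IH] q P lP sP.
  have [y] := lP 1%N; rewrite visits1.
  case: (boolP (y \in P)) => [/set_mem /sP [] //|_].
  by rewrite muln0.
have [h|nl] := pselect (exists q', large q' (P `&` C i)); first by exists i.
have [||i' [q' lq']] := IH (2 * (2 * q))%N (P `\` C i).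
- apply: often_large_large => L0.
  have [L1 hL1] : exists L1, forall L y, (L1 <= L)%N -> (2 * q * visits S (P `&` C i) y L < L)%N.
    apply: contrapT => h; apply: nl; exists (2 * (2 * q))%N.
    apply: often_large_large => L1; apply: contrapT => h'; apply: h.
    exists L1 => L y L1L; rewrite ltnNge; apply/negP => hL; apply: h'.
    by exists L, y.
  pose L := maxn L0 L1; have [y hy] := lP L.
  exists L, y; split; first exact: leq_maxl.
  have := hL1 L y (leq_maxr _ _).
  have vgb : (visits S P y L <= visits S (P `&` C i) y L + visits S (P `\` C i) y L)%N.
    rewrite -visits_modular; apply: leq_trans (leq_addr _ _).
    by apply: visits_subset => w Pw; have [g|g] := pselect (C i w); [left|right].
  have := leq_mul (leqnn q) vgb; rewrite mulnDr.
  lia.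
- move=> y [Py nC]; have [i'] := sP _ Py.
  by rewrite inE => /predU1P[->//|i's] Ci'; exists i'.
exists i', q'; apply: large_subset lq' => w [[Pw _] Cw]; by split.
Qed.

(** Alternate two operations: keep the good points of the current set, then cut
    it by a piece of a cover, the pieces getting smaller and smaller. All sets
    obtained are large; a common point [u] is good for each of them, and each
    neighbourhood of [u] contains one of them. The hypotheses on [B] say that its
    members are closed neighbourhoods which become uniformly small. *)
Lemma large_dense_visits (B : nat -> E -> set E) q P :
  (forall k v, closed (B k v)) -> (forall k v, nbhs v (B k v)) ->
  (forall u V, nbhs u V -> exists k, forall v, B k v u -> B k v `<=` V) ->
  closed P -> large q P ->
  exists2 u, P u & forall V, nbhs u V ->
    exists q', forall L, (L <= q' * visits S V u L)%N.
Proof.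
move=> cB nB dB cP lP.
pose st := {s : set E * nat | closed s.1 /\ large s.2 s.1}.
have step (ks : nat * st) : exists s' : st,
    (sval s').1 `<=` good (sval ks.2).2 (sval ks.2).1 /\
    exists v, (sval s').1 `<=` B ks.1 v.
  case: ks => k [[P' q'] /= [cP' lP']].
  have [cG lG] := large_good cP' lP'.
  have [s [_ hs]] := compact_finite_subcover cE (fun v _ => nB k v).
  have [v [q'' lv]] := large_pigeonhole (C := B k) (s := s) lG (fun y _ => hs y Logic.I).
  have cv : closed (good q' P' `&` B k v) by exact: closedI.
  exists (exist _ (good q' P' `&` B k v, q'') (conj cv lv)) => /=.
  by split => [w []//|]; exists v => w [].
have [f hf] := choice step.
pose s0 : st := exist _ (P, q) (conj cP lP).
pose s := fix s k := if k is k'.+1 then f (k', s k') else s0.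
have sS k : s k.+1 = f (k, s k) by [].
pose Q k := (sval (s k)).1.
have QS k : Q k.+1 `<=` good (sval (s k)).2 (Q k) by rewrite /Q sS; have [] := hf (k, s k).
have [u hu] : exists u, forall k, Q k u.
  apply: compact_bigcap_nonempty => // k.
  - by have [] := svalP (s k).
  - have [_ lk] := svalP (s k); have [y] := lk 1%N; rewrite visits1.
    case: (boolP (y \in _)) => [/set_mem Qy _|_]; first by exists y.
    by rewrite muln0.
  - by move=> w /QS [].
exists u; first exact: (hu 0%N).
move=> V /dB [k hk]; have [_ [v Qv]] := hf (k, s k).
have QV : Q k.+1 `<=` V by apply: subset_trans (hk v (Qv _ (hu k.+1))).
have [_ gu] := QS _ _ (hu k.+2).
exists (2 * (sval (s k.+1)).2)%N => L; apply: leq_trans (gu L) _.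
by rewrite leq_mul2l visits_subset ?orbT.
Qed.

End LargeSets.

Section BanachDensity.
Variable R : realType.

Lemma F_pubd_of_bound (A : set nat) q :
  (forall L, (L <= q * \sum_(0 <= k < L) (k \in A))%N) -> F_pubd R A.
Proof.
move=> hA; rewrite /F_pubd /= /upper_banach_density limf_esupE.
have q0 : (0 < q)%N by have := hA 1%N; case: (q) => //; rewrite mul0n.
apply: (@lt_le_trans _ _ ((q%:R : R)^-1)%:E); first by rewrite lte_fin invr_gt0 ltr0n.
apply: le_ereal_inf_tmp => _ [V [N VN] <-].
apply: le_ereal_sup_tmp; eexists; first by exists (0%N, N.+1) => //; apply: VN.
rewrite lee_fin subn0 /= ler_pdivlMr ?ltr0n // mulrC ler_pdivrMr ?ltr0n //.
by rewrite -natrM ler_nat mulnC hA.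
Qed.

Lemma F_pubd_bound (A : set nat) : F_pubd R A ->
  exists q, forall L0, exists a b,
    (a + L0 <= b)%N /\ (b - a <= q * \sum_(a <= k < b) (k \in A))%N.
Proof.
rewrite /F_pubd /= /upper_banach_density limf_esupE => hA.
have [d [d0 dA]] : exists d : R, 0 < d /\ (d%:E < ereal_inf
    [set ereal_sup ((fun p : nat * nat => ((\sum_(p.1 <= k < p.2) (k \in A))%N%:R /
      (p.2 - p.1)%N%:R)%:E) @` V) | V in gap_to_infty])%E.
  move: hA; set x := ereal_inf _; case: x => [x|_|//].
    rewrite lte_fin => x0; exists (x / 2); rewrite lte_fin; split; lra.
  by exists 1; split; [exact: ltr01|exact: ltry].
pose q := (Num.truncn d^-1).+1.
have qd : d^-1 < q%:R by exact: truncnS_gt.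
exists q => L0.
pose V := [set p : nat * nat | (p.1 + L0.+1 <= p.2)%N].
have : (d%:E < ereal_sup ((fun p : nat * nat => ((\sum_(p.1 <= k < p.2) (k \in A))%N%:R /
      (p.2 - p.1)%N%:R)%:E : \bar R) @` V))%E.
  apply: (lt_le_trans dA); apply: ereal_inf_lbound; exists V => //.
  by exists L0.+1.
move=> /ereal_sup_gt [_ [[a b] /= ab <-]]; rewrite lte_fin => h.
have {}ab : (a + L0.+1 <= b)%N by [].
exists a, b; split; first lia.
have ba : 0 < (b - a)%N%:R :> R by rewrite ltr0n; lia.
rewrite -(ler_nat R) natrM.
move: h; rewrite ltr_pdivlMr // => h.
apply: ltW; rewrite -(ltr_pM2l d0) (lt_le_trans h) // mulrA ler_peMl ?ler0n //.
by move: qd; rewrite -(ltr_pM2l d0) divff ?gt_eqF // => /ltW.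
Qed.

Lemma F_pubd_unbounded A : F_pubd R A -> forall k, exists2 p, (k <= p)%N & A p.
Proof.
move=> /F_pubd_bound [q hq] k; apply: contrapT => h.
have [a [b [ab hb]]] := hq (q * k).+1.
have : (\sum_(a <= i < b) (i \in A) <= k)%N.
  have Ak i : (i \in A <= (i < k))%N.
    case: (boolP (i \in A)) => // /set_mem Ai; rewrite lt0b ltnNge.
    by apply/negP => ki; apply: h; exists i.
  apply: (@leq_trans (\sum_(a <= i < b) (i < k))%N); first exact: leq_sum.
  have : (\sum_(a <= i < b) (i < k) <= \sum_(0 <= i < b) (i < k))%N.
    by rewrite (@big_cat_nat _ _ _ a 0 b) //= ?leq_addl //; lia.
  move=> /leq_trans; apply; elim: b {ab hb} => [|b IH]; first by rewrite big_geq.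
  rewrite big_nat_recr //=; case: (ltnP b k) => bk; last by rewrite addn0.
  apply: leq_trans bk; rewrite addn1 ltnS.
  apply: (@leq_trans (\sum_(0 <= i < b) 1)%N); last by rewrite sum_nat_const_nat muln1 subn0.
  by apply: leq_sum => i _; case: (_ < _)%N.
move=> hk; have : (q * \sum_(a <= i < b) (i \in A) <= q * k)%N by rewrite leq_mul2l hk orbT.
lia.
Qed.

Lemma F_pubd_visits_recurrent (E : topologicalType) (S : E -> E)
    (B : nat -> E -> set E) (W : set E) (A : set nat) z :
  compact [set: E] -> continuous S ->
  (forall k v, closed (B k v)) -> (forall k v, nbhs v (B k v)) ->
  (forall u V, nbhs u V -> exists k, forall v, B k v u -> B k v `<=` V) ->
  closed W -> F_pubd R A -> (forall p, A p -> (1 <= p)%N -> W (iter p S z)) ->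
  exists2 u, W u & recurrent_point (F_pubd R) S u.
Proof.
move=> cE cS cB nB dB cW /F_pubd_bound [q hq] Wz.
have lW : large S (2 * (2 * q)) W.
  apply: often_large_large => L0.
  have [a [b [ab hb]]] := hq (L0 + 2 * q).+1.
  exists (b - a.+1)%N, (iter a.+1 S z); split; first lia.
  (* The first time of the window may be 0, about which nothing is assumed. *)
  have : (\sum_(a <= i < b) (i \in A) <= 1 + visits S W (iter a.+1 S z) (b - a.+1))%N.
    rewrite big_ltn; last lia.
    apply: leq_add; first by case: (_ \in _).
    rewrite /visits -{1}[a.+1]add0n big_addn; apply: leq_sum => i _.
    case: (boolP (_ \in A)) => // /set_mem /Wz h.
    by rewrite mem_set // -iterD; apply: h; lia.
  move=> h; have := leq_trans hb (leq_mul (leqnn q) h).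
  rewrite mulnDr muln1; lia.
have [u Wu hu] := large_dense_visits cE cS cB nB dB cW lW.
exists u => // V /hu [q' hV]; apply: (@F_pubd_of_bound _ q') => L.
apply: leq_trans (hV L) _; rewrite leq_mul2l; apply/orP; right.
apply: leq_sum => k _; case: (boolP (_ \in V)) => // /set_mem h.
by rewrite mem_set.
Qed.

End BanachDensity.

(** * From broken sensitivity to a recurrent tuple in a fibre *)

Section Sensitive.
Variables (R : realType) (X Xeq : metricType R) (T : X -> X).
Variables (Teq : Xeq -> Xeq) (pi : X -> Xeq) (n : nat).
Hypotheses (sT : is_system T) (eT : is_equicontinuous Teq).
Hypothesis fpi : is_factor_map T Teq pi.

(** Take a cluster point [z] of the separated tuples, started in smaller and
    smaller balls around one point. Their images under [pi] start close to each
    other and remain so by equicontinuity, so that [z] lies in a fibre. *)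
Lemma broken_sensitive_orbit (F : set (set nat)) :
  broken_sensitive F n T -> exists d A (z : {ptws 'I_n -> X}),
  [/\ 0 < d, F A, forall i j, pi (z i) = pi (z j) &
    forall p, A p -> (1 <= p)%N -> forall i j : 'I_n, (i < j)%N ->
      d <= mdist (iter p T (z i)) (iter p T (z j))].
Proof.
move=> [d [d0 [A FA hA]]]; have [cpi _ piT] := fpi.
have [x0 _] := system_nonempty sT; have cT := system_continuous sT.
have /choice [xm hxm] : forall l, exists y : {ptws 'I_n -> X} * nat,
    (forall i, mdist x0 (y.1 i) < l.+1%:R^-1) /\
    forall p : nat, A p -> (1 <= p <= l.+1)%N ->
      forall i j : 'I_n, (i < j)%N ->
      d < mdist (iter (y.2 + p) T (y.1 i)) (iter (y.2 + p) T (y.1 j)).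
  move=> l.
  have [||x [m [xU hx]]] := hA [set y | mdist x0 y < l.+1%:R^-1] _ _ l.+1 isT.
  - by apply: open_mdist_lt => y; [exact: cvg_cst|exact: cvg_id].
  - by exists x0; rewrite /= mdistxx invr_gt0.
  by exists (x, m).
pose w l : {ptws 'I_n -> X} := fun i => iter (xm l).2 T ((xm l).1 i).
have [|z [_ clz]] := @ptws_compact R X n (system_compact sT) (w @ \oo)
  (fmap_proper_filter w eventually_filter).
  by exists 0%N.
have freq (V : set {ptws 'I_n -> X}) l0 : nbhs z V -> exists2 l, (l0 <= l)%N & V (w l).
  move=> zV; have [|_ [[l /= l0l <-] Vl]] := clz (w @` [set l | (l0 <= l)%N]) V _ zV.
    by exists l0 => // l l0l; exists l.
  by exists l.
exists d, A, z; split => // [i j|p Ap p1 i j ij].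
  apply: mdist_positivity; apply/eqP; rewrite eq_le mdist_ge0 andbT.
  apply/ler_addgt0Pl => e e0; rewrite addr0.
  have [d1 d10 hd1] := eT (e0 : 0 < e).
  (* Equicontinuity only speaks of times at least 1: the minimum with [e]
     takes care of the case where the tuple is observed at time 0. *)
  have [c c0 hc] : exists2 c : R, 0 < c & forall x, mdist x0 x < c ->
      mdist (pi x0) (pi x) < Num.min d1 e / 2.
    have me : 0 < Num.min d1 e / 2 by rewrite divr_gt0 // lt_min d10.
    apply/(@nbhs_mdistP _ _ _ [set x | mdist (pi x0) (pi x) < Num.min d1 e / 2]).
    exact: (cpi x0 _ (near_mdist_lt (pi x0) me)).
  pose l0 := (Num.truncn c^-1).+1.
  have l0c l : (l0 <= l)%N -> l.+1%:R^-1 < c.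
    move=> l0l; rewrite invf_plt ?posrE //.
    apply: lt_le_trans (truncnS_gt _) _; rewrite ler_nat; exact: leqW.
  rewrite leNgt; apply/negP => ez.
  have oe : open [set v : {ptws 'I_n -> X} | e < mdist (pi (v i)) (pi (v j))].
    apply: (@open_mdist_gt _ _ _ (fun v : {ptws 'I_n -> X} => pi (v i)) (fun v => pi (v j))) => v.
      exact: (@ptws_coord_comp_continuous _ _ _ _ pi i cpi v).
    exact: (@ptws_coord_comp_continuous _ _ _ _ pi j cpi v).
  have [l l0l] := freq _ l0 (open_nbhs_nbhs (conj oe ez)).
  apply/negP; rewrite -leNgt /w.
  have piTr k x : pi (iter k T x) = iter k Teq (pi x).
    by elim: k => //= k IH; rewrite piT IH.
  have [hx _] := hxm l.
  have close i' : mdist (pi x0) (pi ((xm l).1 i')) < Num.min d1 e / 2.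
    by apply: hc; apply: lt_trans (hx i') (l0c _ l0l).
  have lmin : mdist (pi ((xm l).1 i)) (pi ((xm l).1 j)) < Num.min d1 e.
    have := metric_triangle (pi ((xm l).1 i)) (pi x0) (pi ((xm l).1 j)).
    rewrite (metric_sym _ (pi x0)); have := close i; have := close j; lra.
  move: lmin; rewrite lt_min => /andP[ld le]; rewrite !piTr.
  by case: (xm l).2 => [|k]; apply: ltW => //; exact: hd1.
rewrite leNgt; apply/negP => zd.
have od : open [set v : {ptws 'I_n -> X} | mdist (iter p T (v i)) (iter p T (v j)) < d].
  apply: (@open_mdist_lt _ _ _ (fun v : {ptws 'I_n -> X} => iter p T (v i)) (fun v => iter p T (v j))) => v.
    exact: (@ptws_coord_comp_continuous _ _ _ _ (iter p T) i (@continuous_iter _ _ cT p) v).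
  exact: (@ptws_coord_comp_continuous _ _ _ _ (iter p T) j (@continuous_iter _ _ cT p) v).
have [l pl] := freq _ p (open_nbhs_nbhs (conj od zd)).
have [_ hl] := hxm l; have := hl p Ap _ i j ij; rewrite p1 (leqW pl) => /(_ isT).
rewrite /w /= -!iterD addnC => h1 /(lt_trans h1); rewrite ltxx //.
Qed.

(** Both recurrence results are applied to the closed set of the [d]-separated
    tuples contained in a fibre. *)
Lemma broken_sensitive_recurrent_fiber (F : set (set nat)) :
  F = F_ps \/ F = F_pubd R -> broken_sensitive F n T ->
  exists x : {ptws 'I_n -> X}, [/\ forall i j : 'I_n, i <> j -> x i <> x j,
    forall i j, pi (x i) = pi (x j) & recurrent_point F (@prod_map n X T) x].
Proof.
move=> hF /broken_sensitive_orbit [d [A [z [d0 FA piz hz]]]].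
have [cpi _ piT] := fpi; have cT := system_continuous sT.
have cE := ptws_compact (n := n) (system_compact sT).
have cS := prod_map_continuous (n := n) cT.
pose W : set {ptws 'I_n -> X} := [set e | (forall i j, pi (e i) = pi (e j)) /\
  forall i j : 'I_n, (i < j)%N -> d <= mdist (e i) (e j)].
have cW : closed W.
  have -> : W = (\bigcap_(p in [set: 'I_n * 'I_n])
       ~` [set e : {ptws 'I_n -> X} | 0 < mdist (pi (e p.1)) (pi (e p.2))]) `&`
      \bigcap_(p in [set p : 'I_n * 'I_n | (p.1 < p.2)%N])
       ~` [set e : {ptws 'I_n -> X} | mdist (e p.1) (e p.2) < d].
    apply/seteqP; split => e [h1 h2]; split.
    + by move=> [i j] _ /=; rewrite (h1 i j) mdistxx ltxx.
    + by move=> [i j] /= ij; apply/negP; rewrite -leNgt; exact: h2.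
    + move=> i j; apply: mdist_positivity; apply/eqP.
      by have /= /negP := h1 (i, j) Logic.I; rewrite -leNgt eq_le mdist_ge0 andbT.
    + by move=> i j ij; have /= /negP := h2 (i, j) ij; rewrite -leNgt.
  apply: closedI; apply: closed_bigI => -[i j] _ /=; rewrite closedC.
    apply: (@open_mdist_gt _ _ _ (fun v : {ptws 'I_n -> X} => pi (v i)) (fun v => pi (v j))) => v.
      exact: (@ptws_coord_comp_continuous _ _ _ _ pi i cpi v).
    exact: (@ptws_coord_comp_continuous _ _ _ _ pi j cpi v).
  by apply: open_mdist_lt; exact: ptws_coord_continuous.
have piTr k x : pi (iter k T x) = iter k Teq (pi x).
  by elim: k => //= k IH; rewrite piT IH.
have Wz p : A p -> (1 <= p)%N -> W (iter p (@prod_map n X T) z).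
  move=> Ap p1; split => [i j|i j ij]; rewrite !iter_prod_map.
    by rewrite !piTr (piz i j).
  exact: hz.
have [u [upi ud] ru] : exists2 u, W u & recurrent_point F (@prod_map n X T) u.
  case: hF FA => -> FA; first exact: (F_ps_visits_recurrent cE cS cW FA Wz).
  pose B k (v : {ptws 'I_n -> X}) : set {ptws 'I_n -> X} :=
    \bigcap_(i in [set: 'I_n]) ~` [set e | k.+1%:R^-1 < mdist (v i) (e i)].
  apply: (F_pubd_visits_recurrent (B := B) cE cS _ _ _ cW FA Wz).
  - move=> k v; apply: closed_bigI => i _; rewrite closedC.
    apply: open_mdist_gt; last exact: ptws_coord_continuous.
    exact: cst_continuous.
  - move=> k v; apply/ptws_nbhsP; exists k.+1%:R^-1; first by rewrite invr_gt0.
    by move=> e he i _; apply/negP; rewrite -leNgt ltW.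
  - move=> u V /ptws_nbhsP [e e0 eV].
    pose k := (Num.truncn (e / 2)^-1).
    have ke : k.+1%:R^-1 < e / 2.
      by rewrite invf_plt ?posrE ?divr_gt0 //; exact: truncnS_gt.
    exists k => v vu x vx; apply: eV => i.
    have vui : mdist (v i) (u i) <= k.+1%:R^-1.
      by rewrite leNgt; apply/negP; exact: (vu i Logic.I).
    have vxi : mdist (v i) (x i) <= k.+1%:R^-1.
      by rewrite leNgt; apply/negP; exact: (vx i Logic.I).
    have := metric_triangle (u i) (v i) (x i); rewrite (metric_sym (u i) (v i)).
    move: ke vui vxi; move: (_^-1) => c; lra.
exists u; split=> // i j ij uij.
have [h|h|/val_inj//] := ltngtP i j.
  by have := ud _ _ h; rewrite uij mdistxx leNgt d0.
by have := ud _ _ h; rewrite uij mdistxx leNgt d0.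
Qed.

End Sensitive.

Theorem theorem3p2 (R : realType) (n : nat) (hn : (2 <= n)%N)
  (X : metricType R) (T : X -> X) (hT : is_minimal T)
  (Xeq : metricType R) (Teq : Xeq -> Xeq) (pi : X -> Xeq)
  (hpi : is_max_equicontinuous_factor T Teq pi)
  (F : set (set nat)) (hF : F = F_ps \/ F = F_pubd R) :
  broken_sensitive F n T <->
  exists (y : Xeq) (x : {ptws 'I_n -> X}),
    [/\ forall i j : 'I_n, i <> j -> x i <> x j,
        forall i : 'I_n, pi (x i) = y &
        recurrent_point F (prod_map T) x].
Proof.
have n0 : (0 < n)%N by exact: ltnW.
have [_ eT fpi _] := hpi; split.
  move=> /(broken_sensitive_recurrent_fiber hT.1 eT fpi hF) [x [xinj xpi rx]].
  by exists (pi (x (Ordinal n0))), x; split.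
move=> [y [x [xinj xy rx]]].
apply: (recurrent_fiber_broken_sensitive hT hpi n0 _ xinj xy rx) => A.
by case: hF => ->; [exact: F_ps_unbounded|exact: F_pubd_unbounded].
Qed.
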